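(* For each fixed integer $s \geq 3$, $f_s(n) = O(\sqrt{n}\,\log n)$ as $n \to \infty$.
   Context: For integers $s \geq 2$ and $n \geq 1$, the Erdős–Rogers function $f_s(n)$ is the maximum integer $m$ such that every $n$-vertex graph containing no complete graph $K_{s+1}$ has a set of $m$ vertices whose induced subgraph contains no $K_s$. *)

(* Defs.v *)
From mathcomp Require Import all_boot.
Set Implicit Arguments. Unset Strict Implicit. Unset Printing Implicit Defensive.

Definition simple_graph (T : finType) (E : {ffun T * T -> bool}) : bool :=
  [forall x, ~~ E (x, x)] && [forall x, forall y, E (x, y) == E (y, x)].

Definition is_clique (T : finType) (E : {ffun T * T -> bool}) (A : {set T}) : bool :=
  [forall x in A, forall y in A, (x != y) ==> E (x, y)].

Definition contains_K (T : finType) (E : {ffun T * T -> bool}) (A : {set T}) (k : nat) : bool :=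
  [exists B : {set T}, [&& B \subset A, #|B| == k & is_clique E B]].

Definition K_free (T : finType) (E : {ffun T * T -> bool}) (k : nat) : bool :=
  ~~ contains_K E [set: T] k.

Definition ER_prop (s n m : nat) : bool :=
  [forall E : {ffun 'I_n * 'I_n -> bool},
     (simple_graph E && K_free E s.+1) ==>
     [exists A : {set 'I_n}, (#|A| == m) && ~~ contains_K E A s]].

(* Erdos--Rogers function f_s(n): the maximum m with ER_prop s n m.
   (Any such m satisfies m <= n, and m = 0 always works when s >= 1.) *)
Definition f_ER (s n : nat) : nat := \max_(m < n.+1 | ER_prop s n m) m.

(* Main.v *)
(* The K_{s+1}-free graph is built from random blocks. Each of b blocks takes every
   vertex independently with probability 1/(4m) and gives it one of s colours; a pair
   with different colours in block i becomes an edge labelled i unless it would close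
   a triangle with an edge of an earlier block. Then every clique has a single label,
   so it lies in one block and has at most s vertices.

   Fix a set X of m vertices. Conditionally on the earlier blocks, a new block meets
   X in exactly a rainbow K_s of admissible pairs with probability at least 1/c0,
   provided few pairs of X are at distance two in the union of the earlier blocks.
   With b of order m log n blocks a union bound over all X is affordable.

   A set X with too many pairs at distance two contains, by two greedy choices, sets Y
   and Z of only l = O(log n) vertices, no two in a common block, with a positive
   proportion of the pairs of Y x Z at distance two, and such that no midpoint sees
   more than 6 blocks of Y. An exponential moment bound makes this so unlikely that
   the union over the 2^(O(l^2)) pairs (Y, Z) is harmless. *)
Require Import Defs.
From mathcomp Require Import all_boot all_order all_algebra.
From mathcomp Require Import ring lra zify.
Set Implicit Arguments. Unset Strict Implicit. Unset Printing Implicit Defensive.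
Import Order.TTheory GRing.Theory Num.Theory.
Local Open Scope ring_scope.

(** * Averages and independence *)

Section Average.
Variable W : finType.
Implicit Types (f g : W -> rat) (A B : pred W).

Definition avg f : rat := (\sum_w f w) / #|W|%:R.
Definition prob A : rat := avg (fun w => (A w)%:R).

Lemma le_avg f g : (forall w, f w <= g w) -> avg f <= avg g.
Proof. by move=> fg; rewrite ler_wpM2r ?invr_ge0 ?ler0n ?ler_sum. Qed.

Lemma eq_avg f g : f =1 g -> avg f = avg g.
Proof. by move=> fg; rewrite /avg (eq_bigr g). Qed.

Lemma avg_ge0 f : (forall w, 0 <= f w) -> 0 <= avg f.
Proof. by move=> f0; rewrite mulr_ge0 ?invr_ge0 ?ler0n ?sumr_ge0. Qed.

Lemma avgD f g : avg (fun w => f w + g w) = avg f + avg g.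
Proof. by rewrite /avg big_split mulrDl. Qed.

Lemma avg_sum (I : finType) (P : pred I) (F : I -> W -> rat) :
  avg (fun w => \sum_(i | P i) F i w) = \sum_(i | P i) avg (F i).
Proof. by rewrite /avg exchange_big mulr_suml. Qed.

Lemma avgZ c f : avg (fun w => c * f w) = c * avg f.
Proof. by rewrite /avg -mulr_sumr mulrA. Qed.

Lemma avg_cst c : (0 < #|W|)%N -> avg (fun=> c) = c.
Proof.
move=> W0; rewrite /avg sumr_const -[c *+ _]mulr_natr mulfK //.
by rewrite pnatr_eq0 -lt0n.
Qed.

Lemma le_prob A B : (forall w, A w -> B w) -> prob A <= prob B.
Proof.
move=> AB; apply: le_avg => w; rewrite ler_nat.
by case: (A w) (AB w) => // ->.
Qed.

Lemma probU A B : prob (fun w => A w || B w) <= prob A + prob B.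
Proof.
rewrite -avgD; apply: le_avg => w; rewrite -natrD ler_nat.
by case: (A w); case: (B w).
Qed.

Lemma prob_exists (I : finType) (P : pred I) (F : I -> pred W) :
  prob (fun w => [exists i, P i && F i w]) <= \sum_(i | P i) prob (F i).
Proof.
rewrite -avg_sum; apply: le_avg => w; rewrite -natr_sum ler_nat.
by case: existsP => // -[i /andP[Pi Fi]]; rewrite (bigD1 i) //= Fi.
Qed.

Lemma prob_exists_le (I : finType) (P : pred I) (F : I -> pred W) (n : nat) c :
  (#|P| <= n)%N -> (forall i, P i -> prob (F i) <= c) -> 0 <= c ->
  prob (fun w => [exists i, P i && F i w]) <= n%:R * c.
Proof.
move=> Pn Fc c0; apply: (le_trans (prob_exists _ _)).
apply: (le_trans (ler_sum _ Fc)).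
by rewrite sumr_const -[c *+ _]mulr_natl ler_wpM2r ?ler_nat.
Qed.

Lemma markov A f t :
  (forall w, 0 <= f w) -> (forall w, A w -> t <= f w) -> prob A * t <= avg f.
Proof.
move=> f0 At; rewrite mulrC -avgZ; apply: le_avg => w.
by case E: (A w); rewrite ?mulr1 ?mulr0 // At.
Qed.

Lemma prob_lt1 A : (0 < #|W|)%N -> prob A < 1 -> exists w, ~~ A w.
Proof.
move=> W0; case: (boolP [exists w, ~~ A w]) => [/existsP//|/existsPn allA].
rewrite -[X in _ < X](avg_cst 1 W0) ltNge => /negP; case.
by apply: le_avg => w; have := allA w; rewrite negbK => ->.
Qed.

End Average.

(** Independence of the coordinates: the product of the coordinate sums expands into a sum over all
    functions. *)
Lemma avg_prod (I T : finType) (g : I -> T -> rat) :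
  avg (fun f : {ffun I -> T} => \prod_i g i (f i)) = \prod_i avg (g i).
Proof.
rewrite /avg big_split /= bigA_distr_bigA; congr (_ * _).
by rewrite card_ffun natrX prodr_const exprVn.
Qed.

Lemma avg_coord (I T : finType) (k : I) (g : T -> rat) : (0 < #|T|)%N ->
  avg (fun f : {ffun I -> T} => g (f k)) = avg g.
Proof.
move=> T0; have := avg_prod (fun i => if i == k then g else fun=> 1).
rewrite (bigD1 k) //= eqxx big1 ?mulr1 => [<-|i /negPf->]; last exact: avg_cst.
apply: eq_avg => f; rewrite (bigD1 k) //= eqxx big1 ?mulr1 // => i /negPf.
by move=> ->.
Qed.

(** * Resampling part of the randomness *)

Section Resample.
Variables (V B T : finType).
Notation Om := {ffun V -> {ffun B -> T}}.
Implicit Types (S : V -> B -> bool) (w : Om).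

Definition mix S w (w' : Om) : Om :=
  [ffun v => [ffun i => if S v i then w' v i else w v i]].

(** Swapping the entries selected by [S] between two samples is an involution on pairs, so
    [mix S w w'] is again uniform. The inner average acts as a conditional expectation given the
    entries outside [S]. *)
Lemma avg_mix S (F : Om -> rat) :
  avg F = avg (fun w => avg (fun w' => F (mix S w w'))).
Proof.
have [Om0|Om0] := posnP #|{: Om}|.
  by rewrite /avg Om0 invr0 !mulr0.
rewrite /avg -mulr_suml; congr (_ / _).
rewrite pair_big /=.
pose h (p : Om * Om) := (mix S p.1 p.2, mix S p.2 p.1).
have hK : involutive h.
  move=> [w w']; congr (_, _); apply/ffunP => v; apply/ffunP => i;
  by rewrite !ffunE /=; case: (S v i).
rewrite (reindex_inj (inv_inj hK)) /=.
rewrite (eq_bigr (fun p => F p.1)) => [|[w w'] _]; last first.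
  congr F; apply/ffunP => v; apply/ffunP => i.
  by rewrite !ffunE /=; case: (S v i).
rewrite -(pair_big xpredT xpredT (fun w _ => F w)) /=.
have -> : \sum_w \sum_(w' : Om) F w = (\sum_w F w) * #|{: Om}|%:R.
  by rewrite mulr_suml; apply: eq_bigr => w _; rewrite sumr_const mulr_natr.
by rewrite mulfK // pnatr_eq0 -lt0n.
Qed.

End Resample.

(** * Power inequalities over the rationals *)

Lemma bernoulli (x : rat) n : -1 <= x -> 1 + n%:R * x <= (1 + x) ^+ n.
Proof.
move=> x1; elim: n => [|n IH]; first by rewrite mul0r addr0 expr0.
rewrite exprS; have x0 : 0 <= 1 + x by lra.
apply: le_trans (ler_wpM2l x0 IH); rewrite -[n.+1%:R]natr1 -subr_ge0.
have : 0 <= n%:R * x ^+ 2 by rewrite mulr_ge0 ?ler0n ?sqr_ge0.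
by move: n%:R => k; lra.
Qed.

(** From [(1 + y)^n (1 - y)^n <= 1] and Bernoulli's [(1 - y)^n >= 1 - n y], using
    [1 / (1 - z) <= 1 + 2 z] for [0 <= z <= 1/2]. *)
Lemma expr1D_le (y : rat) n : 0 <= y -> n%:R * y <= 2^-1 ->
  (1 + y) ^+ n <= 1 + 2 * (n%:R * y).
Proof.
move=> y0 ny; case: n ny => [|n] ny; first by rewrite mul0r !mulr0 addr0 expr0.
have y1 : y <= 2^-1.
  apply: le_trans ny; rewrite -natr1 mulrDl mul1r lerDr.
  by rewrite mulr_ge0 ?ler0n.
have B : 1 - n.+1%:R * y <= (1 - y) ^+ n.+1.
  have y2 : -1 <= - y by lra.
  by have := bernoulli n.+1 y2; rewrite mulrN.
have P : (1 + y) ^+ n.+1 * (1 - y) ^+ n.+1 <= 1.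
  rewrite -exprMn; apply: exprn_ile1; nra.
have Q : 0 <= (1 + y) ^+ n.+1 by apply: exprn_ge0; lra.
move: P Q B ny; set z := n.+1%:R * y; set a := (1 + y) ^+ _; set b := _ ^+ _.
have z0 : 0 <= z by rewrite mulr_ge0 ?ler0n.
move=> P Q B ny.
have : a * (1 - z) <= 1 by apply: le_trans P; rewrite ler_wpM2l.
nra.
Qed.

(** A rational substitute for [(1 + y)^n <= exp (n y)]. For positive [t] put [z = y / (2 t)]:
    Bernoulli gives [1 + y <= (1 + z)^(2 t)], and [(1 + z)^n <= 2] because [n z <= 1/2]. *)
Lemma expr1D_le4 (y : rat) n t : 0 <= y -> n%:R * y <= t%:R ->
  (1 + y) ^+ n <= 4 ^+ t.
Proof.
case: t => [|t] y0 ny.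
  case: n ny => // n ny; have -> : y = 0; last by rewrite addr0 expr1n.
  apply/eqP; rewrite eq_le y0 andbT; move: ny; rewrite pmulr_rle0 ?ltr0n //.
pose z := y / (2 * t.+1)%:R.
have t0 : 0 < (2 * t.+1)%:R :> rat by rewrite ltr0n.
have z0 : 0 <= z by rewrite divr_ge0 // ltW.
have nz : n%:R * z <= 2^-1.
  rewrite /z mulrA ler_pdivrMr // natrM mulrA mulVf ?mul1r //.
have -> : 4 ^+ t.+1 = (2 ^+ (2 * t.+1)) :> rat.
  by rewrite exprM.
have yz : 1 + y <= (1 + z) ^+ (2 * t.+1).
  apply: le_trans (bernoulli _ _); last by lra.
  by rewrite /z mulrC divfK ?gt_eqF.
apply: (@le_trans _ _ (((1 + z) ^+ (2 * t.+1)) ^+ n)).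
  by rewrite lerXn2r // nnegrE; [lra | rewrite exprn_ge0 //; lra].
rewrite -exprM mulnC exprM lerXn2r // ?nnegrE ?exprn_ge0 //; first by lra.
apply: le_trans (expr1D_le z0 nz) _; lra.
Qed.

(** * The block graph *)

Section BlockGraph.
Variables (V : finType) (b R s : nat).
Notation Om := {ffun V -> {ffun 'I_b -> 'I_R}}.
Implicit Types (w : Om) (i : 'I_b) (k : nat) (x y z v : V) (X : {set V}).
Local Open Scope nat_scope.

(* A value below s is the colour of v in block i; a value at least s leaves v out of
   that block. *)
Definition inb w i v := w v i < s.

Definition share w k x y := [exists i : 'I_b, [&& i < k, inb w i x & inb w i y]].

Definition joined w k x y := [exists v, share w k x v && share w k v y].

Definition lone w i x := [forall z, inb w i z && share w i x z ==> (z == x)].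

(** [lone] excludes triangles with two sides in block [i] and one earlier side; the failure of
    [joined] excludes those with two earlier sides. Sharing a block is tested instead of adjacency,
    so labels need no recursion over earlier labels. *)
Definition lab w i x y :=
  [&& inb w i x, inb w i y, w x i != w y i, lone w i x, lone w i y
    & ~~ joined w i x y].

Definition block_graph w : {ffun V * V -> bool} :=
  [ffun p => [exists i, lab w i p.1 p.2]].

Lemma shareC w k x y : share w k x y = share w k y x.
Proof. by apply: eq_existsb => i; congr (_ && _); rewrite andbC. Qed.

Lemma joinedC w k x y : joined w k x y = joined w k y x.
Proof. by apply: eq_existsb => v; rewrite andbC !(shareC _ _ v). Qed.

Lemma share_refl w k x y : share w k x y -> share w k x x.
Proof.
case/existsP=> i /and3P[ik ix _]; apply/existsP; exists i.
by rewrite ik ix.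
Qed.

Lemma share_joined w k x y : share w k x y -> joined w k x y.
Proof.
by move=> xy; apply/existsP; exists x; rewrite xy (share_refl xy).
Qed.

Lemma share_le w k l x y : k <= l -> share w k x y -> share w l x y.
Proof.
move=> kl /existsP[i /and3P[ik ix iy]]; apply/existsP; exists i.
by rewrite (leq_trans ik kl) ix iy.
Qed.

Lemma joined_le w k l x y : k <= l -> joined w k x y -> joined w l x y.
Proof.
move=> kl /existsP[v /andP[xv vy]]; apply/existsP; exists v.
by rewrite (share_le kl xv) (share_le kl vy).
Qed.

Lemma lab_sym w i x y : lab w i x y = lab w i y x.
Proof.
rewrite /lab joinedC eq_sym; case: (inb w i x); case: (inb w i y) => //=.
by case: (lone w i x); case: (lone w i y).
Qed.

Lemma lab_share w i k x y : i < k -> lab w i x y -> share w k x y.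
Proof.
by move=> ik /and4P[ix iy _ _]; apply/existsP; exists i; rewrite ik ix iy.
Qed.

Lemma block_graph_simple w : simple_graph (block_graph w).
Proof.
apply/andP; split; apply/forallP => x.
  rewrite ffunE; apply/existsP => -[i] /=.
  by rewrite /lab eqxx /= !andbF.
apply/forallP => y; rewrite !ffunE; apply/eqP.
by apply: eq_existsb => i; rewrite lab_sym.
Qed.

(* The latest label occurring in a clique is the label of all its pairs. *)
Lemma block_graph_K_free w : 0 < s -> K_free (block_graph w) s.+1.
Proof.
move=> s0; apply/negP => /existsP[W /and3P[_ /eqP cW /forallP clW]].
have labW x y : x \in W -> y \in W -> x != y -> exists i, lab w i x y.
  move=> xW yW xy; have := clW x; rewrite xW => /forallP/(_ y).
  by rewrite yW xy /= ffunE => /existsP.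
have [x0 [y0 [x0W y0W x0y0]]] : exists x y, [/\ x \in W, y \in W & x != y].
  have : 1 < #|W| by rewrite cW ltnS.
  by case/card_gt1P => x [y [xW yW xy]]; exists x, y.
have [i1 lab1] := labW _ _ x0W y0W x0y0.
pose P i := [exists x in W, exists y in W, lab w i x y].
have P1 : P i1 by apply/exists_inP; exists x0 => //; apply/exists_inP; exists y0.
case: (arg_maxnP (fun i : 'I_b => i : nat) P1) => i /exists_inP[x xW /exists_inP[y yW xy]] imax.
have maxW j u v : u \in W -> v \in W -> lab w j u v -> j <= i.
  by move=> uW vW uv; apply: imax; apply/exists_inP; exists u => //; apply/exists_inP; exists v.
(* If neither [xz] nor [zy] had label [i], both labels would be earlier and [z] would join [x] to
   [y]. *)
have inW z : z \in W -> inb w i z /\ lone w i z.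
  move=> zW; have [->|zx] := eqVneq z x; first by case/and4P: xy => ? _ _ /andP[].
  have [->|zy] := eqVneq z y; first by case/and4P: xy => _ ? _ /and3P[].
  have [j xz] := labW _ _ xW zW (negbT (etrans (eq_sym _ _) (negPf zx))).
  have [k zy'] := labW _ _ zW yW zy.
  have := maxW _ _ _ xW zW xz; rewrite leq_eqVlt => /orP[/eqP/val_inj ji|ji].
    by move: xz; rewrite ji => /and4P[_ ? _ /and3P[]].
  have := maxW _ _ _ zW yW zy'; rewrite leq_eqVlt => /orP[/eqP/val_inj ki|ki].
    by move: zy'; rewrite ki => /and4P[? _ _ /andP[]].
  case/and4P: xy => _ _ _ /and3P[_ _ /negP[]]; apply/existsP; exists z.
  by rewrite (lab_share ji xz) (lab_share ki zy').
(* Two clique vertices of equal colour cannot have label [i], and an earlier label would contradict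
   [lone]. So the clique has at most [s] vertices. *)
have colinj : {in W &, injective (fun z => inord (w z i) : 'I_s.-1.+1)}.
  move=> u v uW vW /(congr1 val); have [iu lu] := inW u uW; have [iv lv] := inW v vW.
  rewrite /= !inordK ?prednK // => uv; apply/eqP; apply/negPn/negP => neq_uv.
  have [j uvj] := labW _ _ uW vW neq_uv.
  have := maxW _ _ _ uW vW uvj; rewrite leq_eqVlt => /orP[/eqP/val_inj ji|ji].
    move: uvj; rewrite ji => /and4P[_ _ /negP[]].
    by apply/eqP/val_inj.
  have /forallP/(_ v) := lu; rewrite iv (lab_share ji uvj) /= eq_sym.
  by rewrite (negPf neq_uv).
have := max_card (mem [set (inord (w z i) : 'I_s.-1.+1) | z in W]).
by rewrite card_in_imset // cW card_ord prednK // ltnn.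
Qed.

Definition nbhd w k x := [set z | share w k x z].

Definition nbhds w k (A : {set V}) := \bigcup_(x in A) nbhd w k x.

(** A vertex of block [i] sharing an earlier block with [t j] is some [t j'] by the last hypothesis,
    and then equals [t j] because sharing implies [joined]. This yields [lone]. *)
Lemma block_graph_contains w i X (t : {ffun 'I_s -> V}) :
  (forall j, t j \in X) -> (forall j, w (t j) i = j :> nat) ->
  (forall j j' : 'I_s, j != j' -> ~~ joined w i (t j) (t j')) ->
  (forall z, z \in X :|: nbhds w i [set t j | j : 'I_s] -> inb w i z ->
     z \in [set t j | j : 'I_s]) ->
  contains_K (block_graph w) X s.
Proof.
move=> tX tw tj tN; apply/existsP; exists [set t j | j : 'I_s].
have tinj : injective t.
  by move=> j j' tt; apply/val_inj; rewrite /= -(tw j) -(tw j') tt.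
have tin j : inb w i (t j) by rewrite /inb tw.
have tl j : lone w i (t j).
  apply/forallP => z; apply/implyP => /andP[iz jz].
  have : z \in [set t j | j : 'I_s].
    apply: tN => //; rewrite inE; apply/orP; right; apply/bigcupP.
    by exists (t j); rewrite ?imset_f // inE.
  case/imsetP => j' _ zj'; rewrite zj' in jz *.
  apply: contraTT (share_joined jz) => neq.
  by apply: tj; apply: contraNneq neq => ->.
rewrite card_imset // card_ord eqxx /=; apply/andP; split.
  by apply/subsetP => _ /imsetP[j _ ->].
apply/forall_inP => _ /imsetP[j _ ->]; apply/forall_inP => _ /imsetP[j' _ ->].
apply/implyP => neq; rewrite ffunE; apply/existsP; exists i.
have jj' : j != j' by apply: contraNneq neq => ->.
rewrite /lab !tin !tl tj //= !andbT.
by apply: contraNneq jj' => /(congr1 val) /=; rewrite !tw => /val_inj ->.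
Qed.

End BlockGraph.

(** * A fixed vertex set *)

Section Survival.
Variables (V : finType) (b R s m : nat).
Hypotheses (s0 : (0 < s)%N) (m0 : (0 < m)%N) (RE : R = (4 * s * m)%N).
Notation Om := {ffun V -> {ffun 'I_b -> 'I_R}}.
Implicit Types (w : Om) (i : 'I_b) (k : nat) (x y z v : V) (X : {set V}).
Implicit Types (t : {ffun 'I_s -> V}).

Definition same_rows k w1 w2 := forall v i, (i < k)%N -> w1 v i = w2 v i.

Lemma same_rows_share k w1 w2 x y :
  same_rows k w1 w2 -> share s w1 k x y = share s w2 k x y.
Proof.
move=> E; apply: eq_existsb => i; have [ik|//] := boolP (i < k)%N.
by rewrite /inb !E.
Qed.

Lemma same_rows_joined k w1 w2 x y :
  same_rows k w1 w2 -> joined s w1 k x y = joined s w2 k x y.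
Proof. by move=> E; apply: eq_existsb => v; rewrite !(same_rows_share _ _ E). Qed.

Lemma same_rows_nbhd k w1 w2 x :
  same_rows k w1 w2 -> nbhd s w1 k x = nbhd s w2 k x.
Proof. by move=> E; apply/setP => z; rewrite !inE (same_rows_share _ _ E). Qed.

(** Equality is included so that a tuple without near pairs is injective. *)
Definition near w k x y := (x == y) || joined s w k x y.

Lemma near_le w k l x y : (k <= l)%N -> near w k x y -> near w l x y.
Proof. by rewrite /near => kl /orP[->//|/(joined_le kl)->]; rewrite orbT. Qed.

Lemma same_rows_near k w1 w2 x y :
  same_rows k w1 w2 -> near w1 k x y = near w2 k x y.
Proof. by move=> E; rewrite /near (same_rows_joined _ _ E). Qed.

Definition nnear w k X := #|[set p in setX X X | near w k p.1 p.2]|.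

(** The first condition leaves at least half of the [s]-tuples of [X] without near pairs; the second
    lets the neighbourhoods of a tuple cover at most [m] vertices. *)
Definition regular w k X :=
  (2 * s ^ 2 * nnear w k X <= m ^ 2)%N &&
  [forall x in X, s * #|nbhd s w k x| <= m]%N.

Lemma same_rows_regular k w1 w2 X :
  same_rows k w1 w2 -> regular w1 k X = regular w2 k X.
Proof.
move=> E; congr ((_ * _ <= _)%N && _).
  by apply: eq_card => p; rewrite !inE (same_rows_near _ _ E).
by apply: eq_forallb => x; rewrite (same_rows_nbhd _ E).
Qed.

Definition img t := [set t j | j : 'I_s].

Definition tuple_ok w k X t := [forall j, t j \in X] &&
  [forall j, forall j', (j != j') ==> ~~ near w k (t j) (t j')].

(** Keeping the rest of [X] out of the block makes hits by different tuples exclusive; keeping the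
    earlier neighbourhoods out provides [lone]. *)
Definition hit w i X t :=
  [&& tuple_ok w i X t, [forall j, w (t j) i == j :> nat] &
    [forall z in X :|: nbhds s w i (img t), inb s w i z ==> (z \in img t)]].

Definition success w i X := [exists t, hit w i X t].

Lemma success_contains w i X :
  success w i X -> contains_K (block_graph s w) X s.
Proof.
case/existsP=> t /and3P[/andP[/forallP tX /forallP tj] /forallP tw /forall_inP tN].
apply: (@block_graph_contains _ _ _ _ w i X t) => //.
- by move=> j; apply/eqP.
- by move=> j j' jj'; have /forallP/(_ j')/implyP/(_ jj')/norP[] := tj j.
by move=> z /tN/implyP.
Qed.

Lemma same_rows_ok k w1 w2 X t :
  same_rows k w1 w2 -> tuple_ok w1 k X t = tuple_ok w2 k X t.
Proof.
move=> E; congr (_ && _); apply: eq_forallb => j; apply: eq_forallb => j'.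
by rewrite (same_rows_near _ _ E).
Qed.

Lemma same_rows_nbhds k w1 w2 A :
  same_rows k w1 w2 -> nbhds s w1 k A = nbhds s w2 k A.
Proof. by move=> E; apply: eq_bigr => x _; apply: same_rows_nbhd. Qed.

Lemma same_rows_success i w1 w2 X :
  same_rows i.+1 w1 w2 -> success w1 i X = success w2 i X.
Proof.
move=> E; have E' : same_rows i w1 w2 by move=> v j ji; apply: E; apply: ltnW.
apply: eq_existsb => t; rewrite /hit (same_rows_ok _ _ E').
rewrite (same_rows_nbhds _ E'); congr [&& _, _ & _].
  by apply: eq_forallb => j; rewrite E.
by apply: eq_forallb => z; rewrite /inb E.
Qed.

Definition in_row i : V -> 'I_b -> bool := fun _ j => j == i.

Lemma same_rows_mix i w w' : same_rows i (mix (in_row i) w w') w.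
Proof.
move=> v j ji; rewrite !ffunE /in_row; case: eqP => // ij.
by rewrite ij ltnn in ji.
Qed.

(* Hence the events [hit t] are disjoint and their probabilities add up. *)
Lemma hit_uniq w i X t t' : hit w i X t -> hit w i X t' -> t = t'.
Proof.
move=> /and3P[_ /forallP tw /forall_inP tN].
move=> /and3P[/andP[/forallP tX' _] /forallP tw' _]; apply/ffunP => j.
have : t' j \in img t.
  have := tN (t' j); rewrite inE tX' => /(_ isT)/implyP; apply.
  by rewrite /inb (eqP (tw' j)).
case/imsetP=> j' _ E; rewrite E; congr (t _); apply/val_inj => /=.
by rewrite -(eqP (tw' j)) E (eqP (tw j')).
Qed.

Lemma colors_gt0 : (0 < R)%N. Proof. by rewrite RE !muln_gt0 s0 m0. Qed.

Lemma prob_color (j : 'I_s) : R%:R^-1 <= prob (fun u : 'I_R => u == j :> nat).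
Proof.
have jR : (j < R)%N.
  by rewrite (leq_trans (ltn_ord j)) // RE mulnAC leq_pmull // muln_gt0 m0.
rewrite /prob /avg card_ord (bigD1 (Ordinal jR)) //= eqxx.
by rewrite ler_peMl ?invr_ge0 ?ler0n // lerDl sumr_ge0 // => u _; rewrite ler0n.
Qed.

Lemma prob_outside : prob (fun u : 'I_R => (s <= u)%N) = 1 - s%:R / R%:R.
Proof.
have sR : (s <= R)%N by rewrite RE mulnAC leq_pmull // muln_gt0 m0.
have colors_gt0' : R%:R != 0 :> rat by rewrite pnatr_eq0 -lt0n colors_gt0.
rewrite /prob /avg card_ord -natr_sum.
rewrite (eq_bigr (fun u : 'I_R => 1 - (u < s))%N); last first.
  by move=> u _; rewrite leqNgt; case: (u < s)%N.
have -> : (\sum_(u < R) (1 - (u < s)) = R - s)%N.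
  rewrite -(big_mkord xpredT (fun u => 1 - (u < s))%N).
  rewrite (big_cat_nat (n := s)) //= big_nat_cond big1 => [|u]; last first.
    by rewrite andbT => /andP[_ ->].
  rewrite add0n big_nat_cond (eq_bigr (fun=> 1%N)); last first.
    by move=> u; rewrite andbT => /andP[su _]; rewrite ltnNge su.
  by rewrite -big_nat_cond sum_nat_const_nat muln1.
by rewrite natrB // mulrBl divff.
Qed.

(** Independence within row [i]: the tuple takes its prescribed colours with probability [R^-s], and
    the at most [2 m] vertices to be avoided all stay out with probability at least
    [1 - 2 m / (4 m) = 1/2]. *)
Lemma prob_hit w i X t : #|X| = m ->
  [forall x in X, s * #|nbhd s w i x| <= m]%N -> tuple_ok w i X t ->
  2^-1 * (R%:R^-1) ^+ s <= prob (fun w' => hit (mix (in_row i) w w') i X t).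
Proof.
move=> cX /forall_inP dX tok; pose N := X :|: nbhds s w i (img t).
have /andP[/forallP tX /forallP tj] := tok.
have cN : (#|N| <= 2 * m)%N.
  have cn : (#|nbhds s w i (img t)| <= m)%N.
    apply: (@leq_trans (\sum_(x in img t) #|nbhd s w i x|)).
      rewrite /nbhds; elim/big_rec2: _ => [|x n A _ IH]; first by rewrite cards0.
      by apply: leq_trans (leq_card_setU _ _) _; rewrite leq_add2l.
    rewrite -(leq_pmul2l s0) big_distrr /=.
    apply: (@leq_trans (\sum_(x in img t) m)).
      by apply: leq_sum => _ /imsetP[j _ ->]; apply: dX.
    rewrite sum_nat_const leq_mul2r (leq_trans (leq_imset_card _ _)) ?orbT //.
    by rewrite cardE size_enum_ord.
  by apply: leq_trans (leq_card_setU _ _) _; rewrite cX mul2n -addnn leq_add2l.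
(* [F v] is the requirement on the single entry of [v] in row [i]; together these requirements imply
   the hit. *)
pose F v (u : 'I_R) := if v \in img t then
    [exists j, (t j == v) && (u == j :> nat)] else (v \in N) ==> (s <= u)%N.
have tinj : injective t.
  move=> j j' tt; apply/eqP; apply: contraT => jj'.
  have /forallP/(_ j')/implyP/(_ jj') := tj j.
  by rewrite /near tt eqxx.
apply: (@le_trans _ _ (prob (fun w' : Om => [forall v, F v (w' v i)]))); last first.
  apply: le_prob => w' /forallP Fw'.
  have E := @same_rows_mix i w w'.
  rewrite /hit (same_rows_ok _ _ E) tok (same_rows_nbhds _ E) /=.
  have mixE v : mix (in_row i) w w' v i = w' v i by rewrite !ffunE /in_row eqxx.
  apply/andP; split.
    apply/forallP => j; have := Fw' (t j); rewrite /F imset_f // mixE.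
    by case/existsP=> j' /andP[/eqP/tinj ->].
  apply/forall_inP => z zN; rewrite /inb mixE; apply/implyP.
  have := Fw' z; rewrite /F; case: ifP => // _.
  by rewrite zN /= leqNgt => /negPf->.
have -> : prob (fun w' : Om => [forall v, F v (w' v i)]) =
          \prod_v prob (F v).
  rewrite -(eq_bigr _ (fun v _ => avg_coord i (fun u => (F v u)%:R) _)) ?card_ord ?colors_gt0 //.
  rewrite -avg_prod; apply: eq_avg => w'.
  case: (boolP [forall v, F v (w' v i)]) => [/forallP FT|].
    by rewrite big1 // => v _; rewrite FT.
  by rewrite negb_forall => /existsP[v /negPf Fv]; rewrite (bigD1 v) //= Fv mul0r.
have Ri0 : 0 <= R%:R^-1 :> rat by rewrite invr_ge0 ler0n.
have sR : s%:R / R%:R = (4 * m%:R)^-1 :> rat.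
  rewrite RE !natrM; field; rewrite !pnatr_eq0 -!lt0n s0 m0 //.
have m4 : 1 <= 4 * m%:R :> rat.
  by rewrite -natrM ler1n muln_gt0 m0.
have q1 : 0 <= 1 - s%:R / R%:R :> rat.
  by rewrite sR subr_ge0 invf_le1 // (lt_le_trans _ m4).
have q1' : 1 - s%:R / R%:R <= 1 :> rat by rewrite sR lerBlDr lerDl invr_ge0 (le_trans _ m4).
rewrite (bigID (fun v => v \in img t)) /= mulrC.
apply: ler_pM; rewrite ?exprn_ge0 //.
- rewrite big_imset /=; last by move=> j j' _ _; apply: tinj.
  rewrite -[s in _ ^+ s]card_ord -prodr_const.
  apply: ler_prod => j _; rewrite Ri0 /=; apply: le_trans (prob_color j) _.
  apply: le_prob => u uj; rewrite /F imset_f //.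
  by apply/existsP; exists j; rewrite eqxx.
(* Extra factors at most 1 only decrease the product, so all of [N], tuple included, may be
   counted. *)
apply: (@le_trans _ _ ((1 - s%:R / R%:R) ^+ #|N|)).
  apply: le_trans (bernoulli _ _); last by lra.
  rewrite sR mulrN lerBrDl -lerBrDr.
  have -> : 1 - 2^-1 = (2 * m%:R) / (4 * m%:R) :> rat.
    by field; rewrite pnatr_eq0 -lt0n.
  rewrite ler_wpM2r ?invr_ge0 ?(le_trans _ m4) //.
  by rewrite -natrM ler_nat.
rewrite -prodr_const [leRHS](bigID (mem N)) /=.
apply: (@le_trans _ _ (\prod_(v | (v \notin img t) && (v \in N)) (1 - s%:R / R%:R))).
  rewrite [leLHS](bigID (mem (img t))) /= [leLHS]mulrC.
  rewrite (eq_bigl (fun v => (v \notin img t) && (v \in N))); last by move=> v; rewrite andbC.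
  by rewrite ler_piMr ?prodr_ge0 // prodr_ile1 // => v _; rewrite q1 q1'.
rewrite -[leLHS]mulr1; apply: ler_pM; rewrite ?prodr_ge0 //.
  apply: ler_prod => v /andP[vt vN]; rewrite q1 -prob_outside.
  by apply: le_prob => u su; rewrite /F (negPf vt) su implybT.
rewrite -[leLHS](_ : \prod_(v | (v \notin img t) && (v \notin N)) 1 = 1); last by rewrite big1.
apply: ler_prod => v /andP[/negPf vt /negPf vN]; rewrite ler01 /=.
have T0 : (0 < #|'I_R|)%N by rewrite card_ord colors_gt0.
rewrite -[leLHS](avg_cst 1 T0).
by apply: le_avg => u; rewrite /F vt vN.
Qed.
End Survival.

(** * Survival through successive blocks *)

Section SurvivalBound.
Variables (V : finType) (b R s m : nat).
Hypotheses (s0 : (0 < s)%N) (m0 : (0 < m)%N) (RE : R = (4 * s * m)%N).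
Notation Om := {ffun V -> {ffun 'I_b -> 'I_R}}.
Implicit Types (w : Om) (i : 'I_b) (k : nat) (x y z v : V) (X : {set V}).
Implicit Types (t : {ffun 'I_s -> V}).

(** A near pair placed at [j] and [j'] leaves [s - 2] free coordinates; the factor [m ^ 2] keeps
    subtraction out of the exponent. *)
Lemma card_tuples_pair w k X (j j' : 'I_s) : #|X| = m -> j != j' ->
  (#|[set t : {ffun 'I_s -> V} | [forall l, t l \in X] && near s w k (t j) (t j')]| * m ^ 2 =
    nnear s w k X * m ^ s)%N.
Proof.
move=> cX jj'; pose E := [set p in setX X X | near s w k p.1 p.2].
pose F (p : V * V) (l : 'I_s) : {set V} :=
  if l == j then [set p.1] else if l == j' then [set p.2] else X.
(* Each tuple is counted once, at [p = (t j, t j')]. Its indicator is a product over coordinates, so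
   the sum over tuples becomes a product of set sizes. *)
have -> : (#|[set t : {ffun 'I_s -> V} | [forall l, t l \in X] && near s w k (t j) (t j')]| =
  \sum_(p in E) \sum_(t : {ffun 'I_s -> V}) \prod_l (t l \in F p l))%N.
  rewrite exchange_big /= -sum1_card big_mkcond; apply: eq_bigr => t _.
  rewrite inE; case: ifP => [/andP[/forallP tX nt]|nt].
    rewrite (bigD1 (t j, t j')) ?inE /= ?tX //=.
    rewrite big1 => [|l _]; last first.
      rewrite /F; case: eqP => [->|_]; first by rewrite inE eqxx.
      by case: eqP => [->|_]; rewrite ?inE ?eqxx ?tX.
    rewrite big1 ?addn0 // => -[p q] /andP[_ npq].
    apply/eqP; rewrite -leqn0 -ltnS; apply: contraT; rewrite -leqNgt => P0.
    case/eqP: npq; have Pl l : t l \in F (p, q) l.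
      by apply: contraLR P0 => /negPf lF; rewrite (bigD1 l) //= lF.
    have := Pl j; have := Pl j'; rewrite /F eqxx eq_sym (negPf jj') eqxx !inE /=.
    by move=> /eqP-> /eqP->.
  rewrite big1 // => -[p q]; rewrite !inE /= => /andP[/andP[pX qX] npq].
  apply/eqP; rewrite -leqn0 -ltnS; apply: contraFT nt; rewrite -leqNgt => P0.
  have Pl l : t l \in F (p, q) l.
    by apply: contraLR P0 => /negPf lF; rewrite (bigD1 l) //= lF.
  have tj : t j = p by have := Pl j; rewrite /F eqxx inE => /eqP.
  have tj' : t j' = q.
    by have := Pl j'; rewrite /F eq_sym (negPf jj') eqxx inE => /eqP.
  rewrite tj tj' npq andbT; apply/forallP => l; have := Pl l; rewrite /F.
  by case: eqP => _; [rewrite inE => /eqP->| case: eqP => _ //; rewrite inE => /eqP->].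
rewrite (eq_bigr (fun p => \prod_l #|F p l|)%N); last first.
  move=> p _; rewrite -(bigA_distr_bigA (fun l x => nat_of_bool (x \in F p l))).
  apply: eq_bigr => l _.
  by rewrite -sum1_card [RHS]big_mkcond; apply: eq_bigr => x _; case: (x \in _).
rewrite big_distrl /= -sum_nat_const; apply: eq_bigr => p _.
pose h (l : 'I_s) := if (l == j) || (l == j') then m else 1%N.
have -> : (m ^ 2 = \prod_l h l)%N.
  rewrite (bigD1 j) // (bigD1 j') /= 1?eq_sym // {1 2}/h !eqxx orbT /=.
  rewrite big1 ?muln1 ?mulnn // => l /andP[lj lj'].
  by rewrite /h (negPf lj) (negPf lj').
rewrite -big_split -[s in RHS]card_ord -prod_nat_const; apply: eq_bigr => l _.
rewrite /h /F; case: eqP => _ /=; first by rewrite cards1 mul1n.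
by case: eqP => _ /=; rewrite ?cards1 ?mul1n ?muln1.
Qed.

(** Union bound: each of at most [s ^ 2] index pairs spoils at most [m ^ s / (2 * s ^ 2)] tuples. *)
Lemma card_tuple_ok w k X : #|X| = m ->
  (2 * s ^ 2 * nnear s w k X <= m ^ 2)%N ->
  (m ^ s <= 2 * #|[set t : {ffun 'I_s -> V} | tuple_ok w k X t]|)%N.
Proof.
move=> cX nX.
pose A := [set t : {ffun 'I_s -> V} | [forall l, t l \in X]].
pose bad (p : 'I_s * 'I_s) := 
  [set t : {ffun 'I_s -> V} | [forall l, t l \in X] && near s w k (t p.1) (t p.2)].
have cA : (#|A| = m ^ s)%N.
  have -> : #|A| = #|ffun_on X : {pred {ffun 'I_s -> V}}|.
    by apply: eq_card => t; rewrite inE; apply/forallP/ffun_onP.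
  by rewrite card_ffun_on cX card_ord.
have AU : A \subset [set t | tuple_ok w k X t] :|:
    \bigcup_(p | p.1 != p.2) bad p.
  apply/subsetP => t; rewrite !inE /tuple_ok => tX; rewrite tX /=.
  apply/orP; case: (boolP [forall j, _]) => [|nt]; [by left|right].
  move: nt; rewrite negb_forall => /existsP[j]; rewrite negb_forall => /existsP[j'].
  rewrite negb_imply negbK => /andP[jj' nt]; apply/bigcupP; exists (j, j') => //.
  by rewrite inE tX.
have cB : (2 * #|\bigcup_(p | p.1 != p.2) bad p| <= m ^ s)%N.
  rewrite -(leq_pmul2r (n1 := 2 * #|_|) (m := m ^ 2)) ?expn_gt0 ?m0 //.
  apply: (@leq_trans (2 * (\sum_(p : 'I_s * 'I_s | p.1 != p.2) #|bad p|) * m ^ 2)).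
    rewrite leq_mul2r leq_mul2l; apply/orP; right; apply/orP; right.
    elim/big_rec2: _ => [|p n B _ IH]; first by rewrite cards0.
    by apply: leq_trans (leq_card_setU _ _) _; rewrite leq_add2l.
  rewrite -mulnA big_distrl /=.
  rewrite (eq_bigr (fun=> nnear s w k X * m ^ s)%N); last first.
    by move=> [j j'] jj'; apply: card_tuples_pair.
  rewrite sum_nat_const mulnA mulnA [leqRHS]mulnC leq_mul2r; apply/orP; right.
  apply: leq_trans nX; rewrite leq_mul2r leq_mul2l; apply/orP; right.
  by rewrite (leq_trans (max_card _)) // card_prod card_ord mulnn.
have := leq_trans (subset_leq_card AU) (leq_card_setU _ _); rewrite cA.
move: cB; set B := #|\bigcup_(_ | _) _|; move: (m ^ s)%N #|_| B => M G B H1 H2.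
rewrite -(leq_add2r M) (leq_trans (n := 2 * (G + B))) //.
  by rewrite addnn -mul2n leq_mul2l.
by rewrite mulnDr leq_add2l.
Qed.

(* A hit by a given admissible tuple has probability at least R^-s / 2, at least m^s / 2
   tuples are admissible, and R = 4 s m. *)
Definition cost := (4 * (4 * s) ^ s)%N.

Lemma prob_success w i X : #|X| = m -> regular s m w i X ->
  cost%:R^-1 <= prob (fun w' => success s (mix (in_row i) w w') i X).
Proof.
move=> cX /andP[nX dX].
have mr : m%:R != 0 :> rat by rewrite pnatr_eq0 -lt0n.
have sr : s%:R != 0 :> rat by rewrite pnatr_eq0 -lt0n.
apply: (@le_trans _ _ (\sum_(t | tuple_ok w i X t)
    prob (fun w' => hit (mix (in_row i) w w') i X t))).
  apply: (@le_trans _ _ (\sum_(t | tuple_ok w i X t) 2^-1 * (R%:R^-1) ^+ s)).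
    rewrite sumr_const -[leRHS]mulr_natl.
    have := card_tuple_ok cX nX; rewrite -(ler_nat rat) natrM natrX cardsE.
    move=> le; have Ri : 0 < 2^-1 * (R%:R^-1) ^+ s :> rat.
      by rewrite mulr_gt0 ?invr_gt0 ?exprn_gt0 ?invr_gt0 ?ltr0n ?(colors_gt0 s0 m0 RE).
    apply: (@le_trans _ _ ((2^-1 * m%:R ^+ s) * (2^-1 * (R%:R^-1) ^+ s))); last first.
      by rewrite ler_pM2r //; lra.
    rewrite /cost RE !natrM natrX natrM exprVn !exprMn.
    by rewrite le_eqVlt; apply/orP; left; apply/eqP; field; rewrite !expf_neq0 // mulf_neq0.
  by apply: ler_sum => t tok; apply: (prob_hit s0 m0 RE).
(* By [hit_uniq] at most one tuple hits, so the sum of indicators is at most the indicator of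
   success. *)
rewrite -avg_sum; apply: le_avg => w'; rewrite -natr_sum ler_nat.
set W := mix _ _ _; case: (boolP (success s W i X)) => [/existsP[t ht]|ns].
  rewrite big_mkcond (bigD1 t) //= big1 ?addn0 => [|t' tt'].
    by case: ifP => //; case: (hit _ _ _ t).
  case: ifP => // _; case E: (hit W i X t') => //.
  by rewrite (hit_uniq ht E) eqxx in tt'.
rewrite big1 // => t _; case E: (hit W i X t) => //.
by case/negP: ns; apply/existsP; exists t.
Qed.

(** Regularity belongs to the event so that [prob_success] applies at every stage. *)
Definition survives k w X :=
  [forall i : 'I_b, (i < k)%N ==> regular s m w i X && ~~ success s w i X].

(** Survival of the first [k] blocks and regularity at block [k] depend only on rows below [k].
    Resampling row [k] leaves them unchanged and costs a factor [1 - 1/cost]. *)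
Lemma prob_survives k X : #|X| = m -> (k <= b)%N ->
  prob (fun w => survives k w X) <= (1 - cost%:R^-1) ^+ k.
Proof.
move=> cX; have OmP : (0 < #|{: Om}|)%N.
  by rewrite !card_ffun !expn_gt0 card_ord (colors_gt0 s0 m0 RE).
have c1 : cost%:R^-1 <= 1 :> rat.
  rewrite invf_le1 ?ltr0n ?ler1n //; by rewrite /cost !muln_gt0 expn_gt0 muln_gt0 s0.
elim: k => [|k IH] kb.
  rewrite expr0 -[leRHS](avg_cst 1 OmP).
  by apply: le_avg => w; rewrite -[1]/(1%:R) ler_nat leq_b1.
pose i := Ordinal kb; rewrite /prob (avg_mix (in_row i)) exprSr.
apply: (@le_trans _ _ (avg (fun w => (survives k w X)%:R * (1 - cost%:R^-1)))); last first.
  rewrite (@eq_avg _ _ (fun w => (1 - cost%:R^-1) * (survives k w X)%:R)); last first.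
    by move=> w; rewrite mulrC.
  by rewrite avgZ mulrC ler_wpM2r ?subr_ge0 ?IH // ltnW.
apply: le_avg => w; pose W w' := mix (in_row i) w w'.
have E w' : same_rows k (W w') w by apply: (@same_rows_mix _ _ _ i).
have survE w' : survives k (W w') X = survives k w X.
  apply: eq_forallb => j; case: (ltnP j k) => //= jk.
  have Ej : same_rows j.+1 (W w') w.
    by move=> v l lj; apply: E; apply: leq_ltn_trans jk.
  have Ej' : same_rows j (W w') w by move=> v l lj; apply: Ej; apply: ltnW.
  by rewrite (same_rows_success s X Ej) (same_rows_regular s m X Ej').
have S w' : survives k.+1 (W w') X ->
    [&& survives k w X, regular s m w i X & ~~ success s (W w') i X].
  move=> /forallP sv; rewrite -(survE w'); apply/andP; split.
    apply/forallP => j; apply/implyP => jk; have /implyP := sv j; apply.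
    exact: ltnW.
  by have := sv i; rewrite ltnSn /= -(same_rows_regular s m X (E w')).
case: (boolP (survives k w X && regular s m w i X)) => [/andP[-> rg]|nr]; last first.
  rewrite (@eq_avg _ _ (fun=> 0)) ?avg_cst ?mulr_ge0 ?ler0n ?subr_ge0 // => w'.
  by case: (boolP (survives _ _ _)) => // /S/and3P[s1 s2]; rewrite s1 s2 in nr.
(* Survival at block [k] excludes success there, so the two probabilities add up to at most 1. *)
rewrite mul1r lerBrDr.
apply: le_trans (lerD (lexx _) (prob_success cX rg)) _; rewrite -avgD.
rewrite -[leRHS](avg_cst 1 OmP); apply: le_avg => w'.
rewrite -natrD -[1]/(1%:R) ler_nat.
case: (boolP (survives _ _ _)) => [/S/and3P[_ _ /negPf->]//|_].
exact: leq_b1.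
Qed.
End SurvivalBound.

(** * Concentration *)

Section Regularity.
Variables (V : finType) (b R s : nat).
Hypotheses (colors_gt0 : (0 < R)%N) (sR : (s <= R)%N).
Notation Col := {ffun 'I_b -> 'I_R}.
Notation Om := {ffun V -> Col}.
Implicit Types (w : Om) (u : Col) (J : {set 'I_b}) (Y Z : {set V}).
Let p : rat := s%:R / R%:R.

Definition cnt J u := #|[set i in J | (u i < s)%N]|.

Lemma dens_ge0 : 0 <= p. Proof. by rewrite divr_ge0 ?ler0n. Qed.

Lemma col_gt0 : (0 < #|{: Col}|)%N.
Proof. by rewrite card_ffun expn_gt0 card_ord colors_gt0. Qed.

Lemma Om_gt0 : (0 < #|{: Om}|)%N.
Proof. by rewrite card_ffun expn_gt0 col_gt0. Qed.

Lemma avg_small (c d : rat) :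
  avg (fun u : 'I_R => if (u < s)%N then c else d) = d + p * (c - d).
Proof.
have Rn : R%:R != 0 :> rat by rewrite pnatr_eq0 -lt0n.
have sumE : \sum_(u < R) (if (u < s)%N then c else d) = s%:R * c + (R%:R - s%:R) * d.
  rewrite -(big_mkord xpredT (fun u : nat => if (u < s)%N then c else d)).
  rewrite (big_cat_nat (n := s)) //=; congr (_ + _).
    rewrite big_nat_cond (eq_bigr (fun=> c)); last first.
      by move=> u; rewrite andbT => /andP[_ ->].
    by rewrite -big_nat_cond sumr_const_nat subn0 mulr_natl.
  rewrite big_nat_cond (eq_bigr (fun=> d)); last first.
    by move=> u; rewrite andbT => /andP[su _]; rewrite ltnNge su.
  by rewrite -big_nat_cond sumr_const_nat -natrB // mulr_natl.
by rewrite /avg card_ord sumE /p; field.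
Qed.

Lemma exp_cnt (c : rat) J u :
  c ^+ cnt J u = \prod_(i in J) (if (u i < s)%N then c else 1).
Proof.
rewrite /cnt -prodr_const [LHS](eq_bigl (fun i => (i \in J) && (u i < s)%N)); last first.
  by move=> i; rewrite inE.
by rewrite -big_mkcondr.
Qed.

(** The moment generating function of a binomial variable. *)
Lemma avg_exp_cnt (c : rat) J :
  avg (fun u : Col => c ^+ cnt J u) = (1 + p * (c - 1)) ^+ #|J|.
Proof.
rewrite (@eq_avg _ _ (fun u : Col =>
  \prod_i (if (i \in J) && (u i < s)%N then c else 1))); last first.
  by move=> u; rewrite exp_cnt [LHS]big_mkcond; apply: eq_bigr => i _; case: (i \in J).
rewrite (avg_prod (fun i (x : 'I_R) => if (i \in J) && (x < s)%N then c else 1)).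
rewrite -prodr_const [RHS]big_mkcond; apply: eq_bigr => i _.
by case: (i \in J) => /=; rewrite ?avg_small // avg_cst // card_ord.
Qed.

Lemma avg_exp_cnt_at (c : rat) J (k : 'I_b) : k \notin J ->
  avg (fun u : Col => (u k < s)%N%:R * c ^+ cnt J u) =
    p * (1 + p * (c - 1)) ^+ #|J|.
Proof.
move=> kJ.
pose g i (x : 'I_R) : rat := if i == k then (x < s)%N%:R else
  if (i \in J) && (x < s)%N then c else 1.
rewrite (@eq_avg _ _ (fun u : Col => \prod_i g i (u i))); last first.
  move=> u; rewrite [RHS](bigD1 k) //= {1}/g eqxx exp_cnt; congr (_ * _).
  rewrite [LHS]big_mkcond [RHS]big_mkcond; apply: eq_bigr => i _ /=; rewrite /g.
  by case: eqVneq => [->|_] /=; [rewrite (negPf kJ)|case: (i \in J)].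
rewrite (avg_prod g) (bigD1 k) //=; congr (_ * _).
  rewrite (@eq_avg _ _ (fun x : 'I_R => if (x < s)%N then 1 else 0)); last first.
    by move=> x; rewrite /g eqxx; case: (x < s)%N.
  by rewrite avg_small subr0 add0r mulr1.
rewrite -prodr_const [LHS]big_mkcond [RHS]big_mkcond; apply: eq_bigr => i _ /=.
rewrite /g; case: eqVneq => [->|_] /=; first by rewrite (negPf kJ).
by case: (i \in J) => /=; rewrite ?avg_small // avg_cst // card_ord.
Qed.

Definition blocks w v : {set 'I_b} := [set i | inb s w i v].

Definition blocksU w Y := \bigcup_(y in Y) blocks w y.

Lemma card_blocks w v : #|blocks w v| = cnt setT (w v).
Proof. by rewrite /cnt; apply: eq_card => i; rewrite !inE. Qed.

(** Exponential Markov inequality with base 2, kept in product form. *)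
Lemma prob_degree D v :
  prob (fun w => D < #|blocks w v|)%N * 2 ^+ D <= (1 + p) ^+ b.
Proof.
apply: (@le_trans _ _ (avg (fun w : Om => 2 ^+ cnt setT (w v)))).
  apply: markov => w; first by rewrite exprn_ge0.
  by rewrite card_blocks => /ltnW; apply: ler_weXn2l; rewrite ler1n.
rewrite (avg_coord v (fun u : Col => 2 ^+ cnt setT u)) ?col_gt0 //.
by rewrite avg_exp_cnt cardsT card_ord (_ : 2 - 1 = 1) ?mulr1.
Qed.

Definition block w (i : 'I_b) : {set V} := [set v | inb s w i v].

Lemma prob_block_size L i :
  prob (fun w => L < #|block w i|)%N * 2 ^+ L <= (1 + p) ^+ #|V|.
Proof.
apply: (@le_trans _ _ (avg (fun w : Om => 2 ^+ #|block w i|))).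
  apply: markov => w; first by rewrite exprn_ge0.
  by move=> /ltnW; apply: ler_weXn2l; rewrite ler1n.
rewrite (@eq_avg _ _ (fun w : Om => \prod_v (if (w v i < s)%N then 2 else 1))); last first.
  move=> w; rewrite -prodr_const [LHS]big_mkcond; apply: eq_bigr => v _.
  by rewrite inE.
rewrite (avg_prod (fun v (u : Col) => if (u i < s)%N then 2 else 1)).
rewrite (eq_bigr (fun=> 1 + p)) ?prodr_const // => v _.
rewrite (avg_coord i (fun x : 'I_R => if (x < s)%N then 2 else 1)) ?card_ord //.
by rewrite avg_small (_ : 2 - 1 = 1) ?mulr1.
Qed.

(* P and f depend only on the columns in Y, and the other columns are independent. *)
Lemma avg_columns Y (P : pred Om) (f : Om -> Col -> rat) y : 0 <= y ->
  (forall w w', {in Y, w =1 w'} -> P w = P w' /\ f w = f w') ->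
  (forall w u, 0 <= f w u) ->
  (forall w, P w -> avg (f w) <= 1 + y) ->
  avg (fun w => (P w)%:R * \prod_(v in ~: Y) f w (w v)) <= (1 + y) ^+ #|V|.
Proof.
move=> y0 PfY f0 Pf; pose S v (_ : 'I_b) := v \notin Y.
rewrite (avg_mix S) -[leRHS](avg_cst _ Om_gt0); apply: le_avg => w.
have mixY w' : {in Y, mix S w w' =1 w}.
  by move=> v vY; apply/ffunP => i; rewrite !ffunE /S vY.
have mixN w' v : v \notin Y -> mix S w w' v = w' v.
  by move=> vY; apply/ffunP => i; rewrite !ffunE /S vY.
case Pw: (P w); last first.
  rewrite (@eq_avg _ _ (fun=> 0)) ?avg_cst ?Om_gt0 // ?exprn_ge0 ?addr_ge0 // => w'.
  by have [-> _] := PfY _ _ (mixY w'); rewrite Pw mul0r.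
rewrite (@eq_avg _ _ (fun w' => \prod_v (if v \in Y then 1 else f w (w' v)))); last first.
  move=> w'; have [-> ->] := PfY _ _ (mixY w'); rewrite Pw mul1r [LHS]big_mkcond.
  apply: eq_bigr => v _; rewrite inE; case: (boolP (v \in Y)) => //= vY.
  by rewrite mixN.
rewrite (avg_prod (fun v u => if v \in Y then 1 else f w u)) -prodr_const.
apply: ler_prod => v _; case: (v \in Y).
  by rewrite avg_cst ?col_gt0 // ler01 lerDl.
by rewrite avg_ge0 ?Pf.
Qed.

Lemma blocksU_local Y Y' w w' : {in Y, w =1 w'} -> Y' \subset Y ->
  blocksU w Y' = blocksU w' Y'.
Proof.
move=> ww' YY'; apply: eq_bigr => y yY; apply/setP => i.
by rewrite !inE /inb ww' // (subsetP YY').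
Qed.

Definition crowded tau w Y :=
  [set v in ~: Y | (tau < cnt (blocksU w Y) (w v))%N].

(** Markov with weight [g] per crowded vertex. One vertex contributes on average at most 1 plus
    [g / g ^ (tau + 1)] times the mean of [g ^ cnt], and that mean is at most [(1 + p g)^N <= 4]. *)
Lemma prob_crowded N tau t (g : nat) Y : (0 < g)%N -> N%:R * (p * g%:R) <= 1 ->
  prob (fun w => (#|blocksU w Y| <= N) && (t <= #|crowded tau w Y|))%N * g%:R ^+ t
    <= (1 + 4 * g%:R / g%:R ^+ tau.+1) ^+ #|V|.
Proof.
move=> g0 Ng; have g1 : 1 <= g%:R :> rat by rewrite ler1n.
have gn0 : 0 < g%:R :> rat by rewrite ltr0n.
pose f w (u : Col) : rat := if (tau < cnt (blocksU w Y) u)%N then g%:R else 1.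
apply: (@le_trans _ _ (avg (fun w => (#|blocksU w Y| <= N)%N%:R *
    \prod_(v in ~: Y) f w (w v)))).
  apply: markov => w.
    rewrite mulr_ge0 ?ler0n ?prodr_ge0 // => v _.
    by rewrite /f; case: ifP; rewrite ?ler0n.
  case/andP=> -> tle; rewrite mul1r -big_mkcondr /=.
  apply: (@le_trans _ _ (g%:R ^+ #|crowded tau w Y|)); first exact: ler_weXn2l.
  rewrite -prodr_const le_eqVlt; apply/orP; left; apply/eqP.
  by apply: eq_bigl => v; rewrite inE.
apply: avg_columns.
- by rewrite divr_ge0 ?mulr_ge0 ?exprn_ge0 ?ler0n.
- by move=> w w' ww'; rewrite /f (blocksU_local ww') //.
- by move=> w u; rewrite /f; case: ifP; rewrite ?ler0n.
move=> w JN; apply: (@le_trans _ _ (1 + g%:R / g%:R ^+ tau.+1 *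
    avg (fun u : Col => g%:R ^+ cnt (blocksU w Y) u))).
  rewrite -avgZ -[X in _ <= X + _](avg_cst 1 col_gt0) -avgD; apply: le_avg => u.
  rewrite /f; case: ifP => tu; last first.
    by rewrite lerDl mulr_ge0 ?divr_ge0 ?exprn_ge0 ?ler0n.
  apply: (@le_trans _ _ (g%:R / g%:R ^+ tau.+1 * g%:R ^+ cnt (blocksU w Y) u)); last first.
    by rewrite lerDr.
  rewrite -mulrA ler_peMr ?ler0n // mulrC ler_pdivlMr ?exprn_gt0 // mul1r.
  exact: ler_weXn2l.
rewrite lerD2l avg_exp_cnt -[leRHS]mulrA [leRHS]mulrC.
apply: ler_wpM2l; first by rewrite divr_ge0 ?exprn_ge0 ?ler0n.
apply: (@le_trans _ _ ((1 + p * g%:R) ^+ N)).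
  apply: (@le_trans _ _ ((1 + p * g%:R) ^+ #|blocksU w Y|)).
    apply: lerXn2r; rewrite ?nnegrE; last by rewrite lerD2l ler_wpM2l ?dens_ge0 // gerBl.
      by rewrite addr_ge0 // mulr_ge0 ?dens_ge0 // subr_ge0.
    by rewrite addr_ge0 // mulr_ge0 ?dens_ge0.
  by apply: ler_weXn2l JN; rewrite lerDl mulr_ge0 ?dens_ge0 ?ler0n.
apply: (@expr1D_le4 _ _ 1) => //; by rewrite mulr_ge0 ?dens_ge0 ?ler0n.
Qed.

(** Counts two-step passages from a block meeting [Y] to a block meeting [Z]. The cap [tau] on the
    [Y] side keeps the exponential weight of a midpoint linear in its count on the [Z] side. *)
Definition crossings tau w Y Z :=
  (\sum_(v in ~: (Y :|: Z) | cnt (blocksU w Y) (w v) <= tau)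
     cnt (blocksU w Y) (w v) * cnt (blocksU w Z) (w v))%N.

(* The weight is at most [1 + cnt J * ((K ^ tau) ^ cnt J' - 1)], whose two factors are
   independent. *)
Lemma avg_crossing (K tau N : nat) J J' : (0 < K)%N ->
  [disjoint J & J'] -> (#|J| <= N)%N -> (#|J'| <= N)%N ->
  N%:R * (p * (K ^ tau)%:R) <= 2^-1 ->
  avg (fun u : Col => if (cnt J u <= tau)%N then K%:R ^+ (cnt J u * cnt J' u) else 1)
    <= 1 + 2 * (N%:R * p) ^+ 2 * (K ^ tau)%:R.
Proof.
move=> K0 dJ JN J'N NK; have p0 := dens_ge0.
set q : rat := (K ^ tau)%:R; have q1 : 1 <= q by rewrite ler1n expn_gt0 K0.
have K1 : 1 <= K%:R :> rat by rewrite ler1n.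
(* Splitting [cnt J] into indicators leaves, for each [k] in [J], a product over [k] and the
   disjoint set [J']. *)
pose h u : rat := \sum_(k in J) ((u k < s)%N%:R * q ^+ cnt J' u + (- 1) * (u k < s)%N%:R).
have hE u : h u = (cnt J u)%:R * (q ^+ cnt J' u - 1).
  rewrite /h (eq_bigr (fun k => (u k < s)%N%:R * (q ^+ cnt J' u - 1))); last first.
    by move=> k _; rewrite mulrBr mulr1 mulN1r.
  rewrite -mulr_suml -natr_sum; congr (_%:R * _).
  rewrite /cnt -sum1_card [RHS](eq_bigl (fun k => (k \in J) && (u k < s)%N)); last first.
    by move=> k; rewrite inE.
  by rewrite [RHS]big_mkcondr; apply: eq_bigr => k _; case: (u k < s)%N.
apply: (@le_trans _ _ (avg (fun u => 1 + h u))).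
  apply: le_avg => u; rewrite hE.
  have h0 : 0 <= q ^+ cnt J' u - 1 by rewrite subr_ge0 exprn_ege1.
  case: ifP => [le|_]; last by rewrite lerDl mulr_ge0 ?ler0n.
  case E: (cnt J u) le => [|c] le; first by rewrite mul0n expr0 mul0r addr0.
  apply: (@le_trans _ _ (1 + 1 * (q ^+ cnt J' u - 1))).
    rewrite mul1r addrC subrK /q natrX -exprM; apply: ler_weXn2l => //.
    by rewrite leq_mul2r le orbT.
  by rewrite lerD2l ler_wpM2r // ler1n.
rewrite avgD avg_cst ?col_gt0 // lerD2l /h avg_sum.
rewrite (eq_bigr (fun=> p * ((1 + p * (q - 1)) ^+ #|J'| - 1))); last first.
  move=> k kJ; rewrite avgD avgZ avg_exp_cnt_at; last first.
    by rewrite (disjointFr dJ kJ).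
  rewrite (_ : avg _ = p); first by rewrite mulN1r [RHS]mulrBr mulr1.
  rewrite (avg_coord k (fun x : 'I_R => (x < s)%N%:R)) ?card_ord //.
  rewrite -[RHS]mulr1 -[X in _ = p * X]subr0 -[RHS]add0r -avg_small.
  by apply: eq_avg => x; case: (x < s)%N.
rewrite sumr_const -[leLHS]mulr_natl.
have le1 : (1 + p * (q - 1)) ^+ #|J'| - 1 <= 2 * (N%:R * (p * q)).
  rewrite lerBlDl; apply: le_trans (expr1D_le _ NK); last by rewrite mulr_ge0 ?ler0n.
  apply: (@le_trans _ _ ((1 + p * q) ^+ #|J'|)).
    apply: lerXn2r; rewrite ?nnegrE; last by rewrite lerD2l ler_wpM2l // gerBl.
      by rewrite addr_ge0 // mulr_ge0 // subr_ge0.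
    by rewrite addr_ge0 // mulr_ge0 // ler0n.
  by apply: ler_weXn2l J'N; rewrite lerDl mulr_ge0 ?ler0n.
have l0 : 0 <= (1 + p * (q - 1)) ^+ #|J'| - 1.
  by rewrite subr_ge0 exprn_ege1 // lerDl mulr_ge0 ?subr_ge0.
rewrite (_ : 2 * _ * q = N%:R * (p * (2 * (N%:R * (p * q))))); last by ring.
by apply: ler_pM; rewrite ?ler_nat ?ler0n //; [apply: mulr_ge0 | apply: ler_wpM2l].
Qed.

(** Markov with weight [2 ^ (8 * c)] per crossing, which reaches [2 ^ (8 * e)] on the event;
    [avg_crossing] bounds the factor of each midpoint. *)
Lemma prob_crossings (N tau c e : nat) Y Z :
  N%:R * (p * ((2 ^ (8 * c)) ^ tau)%:R) <= 2^-1 ->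
  prob (fun w => [&& [disjoint blocksU w Y & blocksU w Z],
      #|blocksU w Y| <= N, #|blocksU w Z| <= N & e <= c * crossings tau w Y Z]%N)
    * 2 ^+ (8 * e)
  <= (1 + 2 * (N%:R * p) ^+ 2 * ((2 ^ (8 * c)) ^ tau)%:R) ^+ #|V|.
Proof.
set K := (2 ^ (8 * c))%N => NK; have K0 : (0 < K)%N by rewrite expn_gt0.
pose J w := blocksU w Y; pose J' w := blocksU w Z.
pose f w (u : Col) : rat :=
  if (cnt (J w) u <= tau)%N then K%:R ^+ (cnt (J w) u * cnt (J' w) u) else 1.
pose P : pred Om := fun w => [&& [disjoint J w & J' w], #|J w| <= N & #|J' w| <= N]%N.
have f0 w u : 0 <= f w u by rewrite /f; case: ifP; rewrite ?exprn_ge0 ?ler0n.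
apply: (@le_trans _ _ (avg (fun w => (P w)%:R *
    \prod_(v in ~: (Y :|: Z)) f w (w v)))).
  apply: markov => w; first by rewrite mulr_ge0 ?ler0n ?prodr_ge0.
  case/and4P=> d1 d2 d3 ec; rewrite /P d1 d2 d3 mul1r -big_mkcondr /=.
  apply: (@le_trans _ _ (K%:R ^+ crossings tau w Y Z)).
    rewrite /K natrX -exprM; apply: ler_weXn2l; first by rewrite ler1n.
    by rewrite -mulnA leq_mul2l.
  by rewrite /crossings expr_sum; apply: lexx.
apply: (@avg_columns _ P f) => //.
- by rewrite mulr_ge0 ?ler0n // mulr_ge0 // sqr_ge0.
- move=> w w' ww'; rewrite /P /f /J /J'.
  by rewrite !(blocksU_local ww') ?subsetUl ?subsetUr.
by move=> w /and3P[d1 d2 d3]; apply: avg_crossing.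
Qed.

End Regularity.

(** * Pairs at distance two *)

(** Vertices related to those already chosen number at most [k * d] and carry weight at most
    [k * d * W <= S / 2]. Some remaining vertex thus has at least the average weight
    [S / (2 * #|X|)]. *)
Lemma greedy_spread (V : finType) (r : rel V) (d : nat) (X : {set V})
    (wt : V -> nat) (W S k : nat) :
  reflexive r -> symmetric r -> (forall x, #|[set z | r x z]| <= d)%N ->
  (forall x, x \in X -> wt x <= W)%N -> (S <= \sum_(x in X) wt x)%N ->
  (0 < S)%N -> (2 * (k * d * W) <= S)%N ->
  exists Z : {set V}, [/\ Z \subset X, #|Z| = k,
    {in Z &, forall z z', z != z' -> ~~ r z z'} &
    forall z, z \in Z -> (S <= 2 * #|X| * wt z)%N].
Proof.
move=> rr rs rd wW SX S0; elim: k => [|k IH] kS.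
  exists set0; split=> [||x y|x]; rewrite ?sub0set ?cards0 ?inE //.
have [|Z [ZX cZ rZ wZ]] := IH.
  by apply: leq_trans kS; rewrite leq_mul2l !leq_mul2r leqnSn !orbT.
pose N := \bigcup_(z in Z) [set y | r z y].
have cN : (#|N| <= k * d)%N.
  apply: (@leq_trans (\sum_(z in Z) d)); last by rewrite sum_nat_const cZ.
  apply: (@leq_trans (\sum_(z in Z) #|[set y | r z y]|)); last exact: leq_sum.
  rewrite /N; elim/big_rec2: _ => [|x n A _ IH']; first by rewrite cards0.
  by apply: leq_trans (leq_card_setU _ _) _; rewrite leq_add2l.
have sumN : (\sum_(x in X :&: N) wt x <= k * d * W)%N.
  apply: (@leq_trans (\sum_(x in X :&: N) W)).
    by apply: leq_sum => x; rewrite inE => /andP[/wW].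
  by rewrite sum_nat_const leq_mul2r (leq_trans _ cN) ?orbT // subset_leq_card // subsetIr.
have sumD : (S <= 2 * \sum_(x in X :\: N) wt x)%N.
  move: SX; rewrite (big_setID N) /= => SX.
  have kS' : (2 * (k * d * W) <= S)%N.
    by apply: leq_trans kS; rewrite leq_mul2l !leq_mul2r leqnSn !orbT.
  rewrite -(leq_add2l S); apply: leq_trans (leq_add SX SX) _.
  by rewrite addnn -mul2n mulnDr leq_add2r (leq_trans _ kS') // leq_mul2l sumN orbT.
have [x xX wx] : exists2 x, x \in X :\: N & (S <= 2 * #|X| * wt x)%N.
  apply/exists_inP; apply: contraT; rewrite negb_exists_in => /forall_inP small.
  have X0 : (0 < #|X :\: N|)%N.
    rewrite lt0n cards_eq0; apply: contraTneq sumD => ->.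
    by rewrite big_set0 muln0 -ltnNge.
  have XX : (#|X :\: N| <= #|X|)%N by rewrite subset_leq_card // subsetDl.
  have : (\sum_(x in X :\: N) (2 * #|X| * wt x) < \sum_(x in X :\: N) S)%N.
    have [y yX] := card_gt0P X0.
    rewrite !(bigD1 y yX) /= -addSn leq_add ?ltnNge ?small //.
    by apply: leq_sum => z /andP[zX _]; rewrite ltnW // ltnNge small.
  rewrite -big_distrr /= sum_nat_const ltnNge => /negP[].
  by rewrite [(2 * _)%N]mulnC -mulnA leq_mul.
case/setDP: xX => xX xN.
have rxZ z : z \in Z -> ~~ r z x.
  by move=> zZ; apply: contra xN => zx; apply/bigcupP; exists z; rewrite ?inE.
have xZ : x \notin Z by apply/negP => /rxZ; rewrite rr.
exists (x |: Z); split.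
- by rewrite subUset sub1set xX.
- by rewrite cardsU1 xZ cZ.
- move=> z z'; rewrite !inE => /orP[/eqP->|zZ] /orP[/eqP->|z'Z] neq.
  + by rewrite eqxx in neq.
  + by rewrite rs rxZ.
  + exact: rxZ.
  + exact: rZ.
by move=> z; rewrite !inE => /orP[/eqP->|/wZ].
Qed.

Lemma card_relX (V : finType) (r : rel V) (A B : {set V}) :
  (#|[set p in setX A B | r p.1 p.2]| = \sum_(x in A) #|[set y in B | r x y]|)%N.
Proof.
rewrite -sum1_card (eq_bigr (fun x => \sum_(y in B | r x y) 1)%N).
  by rewrite pair_big_dep; apply: eq_bigl => -[x y]; rewrite !inE /= andbA.
by move=> x _; rewrite -sum1_card; apply: eq_bigl => y; rewrite inE.
Qed.

Lemma card_relX_sym (V : finType) (r : rel V) (A B : {set V}) :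
  (#|[set p in setX A B | r p.1 p.2]| = \sum_(y in B) #|[set x in A | r x y]|)%N.
Proof.
rewrite card_relX (eq_bigr (fun x => \sum_(y in B | r x y) 1)%N); last first.
  by move=> x _; rewrite -sum1_card; apply: eq_bigl => y; rewrite inE.
rewrite (exchange_big_dep (mem B)) /=; last by move=> x y _ /andP[].
apply: eq_bigr => y yB; rewrite -sum1_card; apply: eq_bigl => x.
by rewrite !inE yB.
Qed.

(** * Deterministic consequences for a typical sample *)

Section Regular.
Variables (V : finType) (b R s m l t D L : nat).
Notation Om := {ffun V -> {ffun 'I_b -> 'I_R}}.
Variable w : Om.
Hypothesis degree_le : forall v, (#|blocks s w v| <= D)%N.
Hypothesis size_le : forall i, (#|block s w i| <= L)%N.

Lemma card_nbhd v : (#|nbhd s w b v| <= D * L)%N.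
Proof.
apply: (@leq_trans #|\bigcup_(i in blocks s w v) block s w i|).
  apply/subset_leq_card/subsetP => z; rewrite inE => /existsP[i /and3P[_ iv iz]].
  by apply/bigcupP; exists i; rewrite inE.
apply: (@leq_trans (\sum_(i in blocks s w v) L)); last first.
  by rewrite sum_nat_const leq_mul2r degree_le orbT.
elim/big_rec2: _ => [|i n A _ IH]; first by rewrite cards0.
by apply: leq_trans (leq_card_setU _ _) _; rewrite addnC [leqRHS]addnC leq_add.
Qed.

Lemma card_blocksU (Y : {set V}) : (#|blocksU s w Y| <= #|Y| * D)%N.
Proof.
rewrite -sum_nat_const /blocksU.
elim/big_rec2: _ => [|i n A _ IH]; first by rewrite cards0.
by apply: leq_trans (leq_card_setU _ _) _; rewrite addnC [leqRHS]addnC leq_add.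
Qed.

Let meets x z := (x == z) || share s w b x z.

(* As no two vertices of Y (of Z) share a block, a path y - i - v - j - z is
   determined by (v, i, j). *)
Lemma crossings_count (Y Z : {set V}) tau :
  {in Y &, forall y y', y != y' -> ~~ meets y y'} ->
  {in Z &, forall y y', y != y' -> ~~ meets y y'} ->
  {in Y & Z, forall y z, ~~ meets y z} ->
  (forall z, z \in Z -> z \notin nbhds s w b (crowded s tau w Y)) ->
  (#|[set p in setX Y Z | near s w b p.1 p.2]| <= crossings s tau w Y Z)%N.
Proof.
move=> YY ZZ YZ Zcr.
pose Tr := [set q : V * ('I_b * 'I_b) |
  [&& q.1 \notin Y :|: Z, (cnt s (blocksU s w Y) (w q.1) <= tau)%N,
   q.2.1 \in blocksU s w Y, inb s w q.2.1 q.1,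
   q.2.2 \in blocksU s w Z & inb s w q.2.2 q.1]].
have -> : crossings s tau w Y Z = #|Tr|.
  rewrite /crossings -sum1_card.
  rewrite (eq_bigr (fun v => \sum_(q : 'I_b * 'I_b |
     [&& q.1 \in blocksU s w Y, inb s w q.1 v, q.2 \in blocksU s w Z & inb s w q.2 v]) 1)%N).
    rewrite pair_big_dep; apply: eq_bigl => -[v [i j]].
    by rewrite !inE /=; case: (v \in Y); case: (v \in Z) => //=.
  move=> v _; rewrite -cardsX -sum1_card; apply: eq_bigl => -[i j].
  by rewrite !inE /= -!andbA.
(* Recovers the endpoints from the two blocks; every near pair will lie in the image of [psi]. *)
pose psi (q : V * ('I_b * 'I_b)) :=
  ([pick y in Y | inb s w q.2.1 y], [pick z in Z | inb s w q.2.2 z]).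
set P := finset _.
have inj2 : injective (fun p : V * V => (Some p.1, Some p.2)).
  by move=> [x y] [x' y'] [-> ->].
rewrite -(card_imset (mem P) inj2); apply: leq_trans (leq_imset_card psi (mem Tr)).
apply/subset_leq_card/subsetP => _ /imsetP[[y z] + ->].
rewrite inE /= inE /= => /andP[/andP[yY zZ] nyz].
have nm := YZ _ _ yY zZ.
have meetsC x x' : meets x x' = meets x' x by rewrite /meets eq_sym shareC.
have jyz : joined s w b y z.
  by move: nyz nm; rewrite /near /meets; case: eqP.
case/existsP: jyz => v /andP[yv vz].
(* A midpoint in [Y] would meet [z], and one in [Z] would meet [y]. *)
have vYZ : v \notin Y :|: Z.
  apply/negP; rewrite inE => /orP[vY|vZ].
    by have := YZ _ _ vY zZ; rewrite /meets vz orbT.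
  by have := YZ _ _ yY vZ; rewrite /meets yv orbT.
case/existsP: (yv) => i /and3P[_ iy iv]; case/existsP: (vz) => j /and3P[_ jv jz].
apply/imsetP; exists (v, (i, j)).
  rewrite inE /= vYZ iv jv /= !andbT; apply/and3P; split.
  - rewrite leqNgt; apply: contra (Zcr _ zZ) => cr; apply/bigcupP; exists v.
      by rewrite !inE cr andbT; move: vYZ; rewrite inE negb_or => /andP[].
    by rewrite inE.
  - by apply/bigcupP; exists y; rewrite ?inE.
  - by apply/bigcupP; exists z; rewrite ?inE.
have uniq (A : {set V}) k x : {in A &, forall y y', y != y' -> ~~ meets y y'} ->
    x \in A -> inb s w k x -> [pick x' in A | inb s w k x'] = Some x.
  move=> AA xA kx; case: pickP => [x' /andP[x'A kx']|/(_ x)]; last by rewrite xA kx.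
  congr Some; apply/eqP; apply: contraT => neq; have := AA _ _ x'A xA neq.
  case/negP; apply/orP; right; apply/existsP; exists k.
  by rewrite ltn_ord kx' kx.
by rewrite /psi /= (uniq Y i y) // (uniq Z j z).
Qed.

Hypothesis l0 : (0 < l)%N.
Hypothesis m0 : (0 < m)%N.
Hypothesis s0 : (0 < s)%N.
Hypothesis crowded_lt : forall Y : {set V}, #|Y| = l ->
  (#|crowded s 6 w Y| <= t)%N.
Hypothesis crossings_lt : forall Y Z : {set V}, #|Y| = l -> #|Z| = l ->
  [disjoint blocksU s w Y & blocksU s w Z] ->
  (16 * s ^ 2 * crossings s 6 w Y Z < l ^ 2)%N.
Hypothesis m_large : (16 * s ^ 2 * ((t + l) * (D * L).+1) <= m)%N.

(* Greedy choice of Y in X, then of Z among the vertices of X that are far from the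
   crowded midpoints of Y; then Y and Z contradict [crossings_lt]. *)
Lemma nnear_le (X : {set V}) : #|X| = m ->
  (2 * s ^ 2 * nnear s w b X <= m ^ 2)%N.
Proof.
move=> cX; rewrite leqNgt; apply/negP; set e := nnear _ _ _ _ => he.
have := m_large; set d := (D * L).+1 => ml.
have mr : reflexive meets by move=> x; rewrite /meets eqxx.
have ms : symmetric meets by move=> x y; rewrite /meets eq_sym shareC.
have md x : (#|[set z | meets x z]| <= d)%N.
  apply: (@leq_trans #|x |: nbhd s w b x|).
    apply/subset_leq_card/subsetP => z; rewrite !inE /meets eq_sym; exact: id.
  by apply: leq_trans (leq_card_setU _ _) _; rewrite cards1 add1n ltnS card_nbhd.
have q0 : (0 < s ^ 2)%N by rewrite expn_gt0 s0.
move: he ml; set q := (s ^ 2)%N in q0 * => he ml.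
pose wt y := #|[set x in X | near s w b y x]|.
have eE : (e = \sum_(y in X) wt y)%N by rewrite /e /nnear card_relX.
have [||||Y [YX cY YY wY]] := @greedy_spread V meets d X wt m e l mr ms md.
- move=> x _; rewrite -cX subset_leq_card //; apply/subsetP => z; rewrite inE.
  by case/andP.
- by rewrite eE.
- by move: he; case: (e) => //; rewrite muln0.
- clear -he ml q0; nia.
pose wt2 x := #|[set y in Y | near s w b y x]|.
(* Double counting of the near pairs between [Y] and [X]. *)
have sum2 : (l * e <= 2 * m * \sum_(x in X) wt2 x)%N.
  rewrite -card_relX_sym card_relX -cY -sum_nat_const big_distrr /=.
  by apply: leq_sum => y yY; rewrite -cX wY.
(* Avoiding [N] keeps [Z] away from crowded midpoints and from all blocks of [Y]. *)
pose N := nbhds s w b (crowded s 6 w Y) :|: \bigcup_(y in Y) [set z | meets y z].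
have cN : (#|N| <= (t + l) * d)%N.
  apply: leq_trans (leq_card_setU _ _) _; rewrite mulnDl leq_add //.
    apply: (@leq_trans (\sum_(x in crowded s 6 w Y) d)).
      rewrite /nbhds; elim/big_rec2: _ => [|x n A _ IH]; first by rewrite cards0.
      rewrite (leq_trans (leq_card_setU _ _)) // leq_add // ltnW // ltnS.
      exact: card_nbhd.
    by rewrite sum_nat_const leq_mul2r crowded_lt ?orbT.
  apply: (@leq_trans (\sum_(x in Y) d)); last by rewrite sum_nat_const cY.
  elim/big_rec2: _ => [|x n A _ IH]; first by rewrite cards0.
  by rewrite (leq_trans (leq_card_setU _ _)) // leq_add.
have wt2l x : (wt2 x <= l)%N.
  by rewrite -cY subset_leq_card //; apply/subsetP => z; rewrite inE => /andP[].
set S2 := (\sum_(x in X :\: N) wt2 x)%N.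
have sumX : (\sum_(x in X) wt2 x <= (t + l) * d * l + S2)%N.
  rewrite (big_setID N) /= leq_add2r.
  apply: (@leq_trans (\sum_(x in X :&: N) l)); first exact: leq_sum.
  by rewrite sum_nat_const leq_mul2r (leq_trans _ cN) ?orbT // subset_leq_card // subsetIr.
(* As [e] exceeds [m ^ 2 / (2 q)], the set [Y] has at least [l m / (4 q)] near pairs with [X];
   deleting [N] loses at most [l m / (16 q)]. *)
have lmS : (l * m <= 8 * q * S2)%N.
  move: sumX sum2; set SX := (\sum_(x in X) wt2 x)%N => sumX sum2.
  have h1 : (l * m <= 4 * q * SX)%N.
    rewrite -(leq_pmul2r m0); clear -he sum2; nia.
  clear -h1 sumX ml; nia.
have S20 : (0 < S2)%N.
  by clear -lmS l0 m0; nia.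
have [||||Z [ZX cZ ZZ wZ]] := @greedy_spread V meets d (X :\: N) wt2 l S2 l mr ms md => //.
- clear -lmS ml q0; nia.
have ZN z : z \in Z -> z \notin N by move=> /(subsetP ZX)/setDP[].
have YZ : {in Y & Z, forall y z, ~~ meets y z}.
  move=> y z yY /ZN; rewrite inE negb_or => /andP[_]; apply: contra => yz.
  by apply/bigcupP; exists y; rewrite ?inE.
have Zcr z : z \in Z -> z \notin nbhds s w b (crowded s 6 w Y).
  by move=> /ZN; rewrite inE negb_or => /andP[].
have le_cross := crossings_count YY ZZ YZ Zcr.
have dJ : [disjoint blocksU s w Y & blocksU s w Z].
  apply/pred0P => i /=; apply/negP => /andP[/bigcupP[y yY iy] /bigcupP[z zZ iz]].
  have /negP[] := YZ _ _ yY zZ; apply/orP; right; apply/existsP; exists i.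
  by rewrite ltn_ord; move: iy iz; rewrite !inE => -> ->.
have := crossings_lt cY cZ dJ; rewrite ltnNge => /negP[]; rewrite -/q.
(* Each [z] is near at least [S2 / (2 m) >= l / (16 q)] vertices of [Y]. *)
apply: (@leq_trans (16 * q * \sum_(z in Z) wt2 z)); last first.
  by rewrite leq_mul2l -card_relX_sym le_cross orbT.
rewrite big_distrr /= expnS expn1 -{1}cZ -sum_nat_const; apply: leq_sum => z zZ.
have XX : (#|X :\: N| <= m)%N by rewrite -cX subset_leq_card // subsetDl.
have wz : (S2 <= 2 * m * wt2 z)%N.
  by apply: leq_trans (wZ _ zZ) _; rewrite leq_mul2r leq_mul2l XX !orbT.
rewrite -(leq_pmul2r m0) (leq_trans lmS) //.
rewrite (leq_trans (n := 8 * q * (2 * m * wt2 z))) ?leq_mul2l ?wz ?orbT //.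
clear; nia.
Qed.

End Regular.

(** * Existence of the graph *)

Lemma card_draws_le (V : finType) (k : nat) :
  (#|[pred A : {set V} | #|A| == k]| <= #|V| ^ k)%N.
Proof.
have -> : #|[pred A : {set V} | #|A| == k]| = 'C(#|V|, k).
  by rewrite -card_draws; apply: eq_card => A; rewrite !inE.
apply: (@leq_trans (#|V| ^_ k)).
  by rewrite -bin_ffact leq_pmulr // fact_gt0.
rewrite ffact_prod -[k in leqRHS]card_ord -prod_nat_const.
by apply: leq_prod => i _; apply: leq_subr.
Qed.

Section Existence.
Variables (V : finType) (s l g M c0 K m R b D : nat).
Hypothesis c0E : c0 = cost s.
(** The quantity [(2 ^ (8 * c)) ^ tau] of [prob_crossings] for [c = 16 * s ^ 2] and crowding cap
    [tau = 6]. *)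
Hypothesis KE : K = ((2 ^ (8 * (16 * s ^ 2))) ^ 6)%N.
Hypothesis mE : m = (M * l ^ 2 * g)%N.
Hypothesis RE : R = (4 * s * m)%N.
Hypothesis bE : b = (2 * c0 * m * l)%N.
Hypothesis DE : D = (2 * c0 * l)%N.
Hypothesis s0 : (0 < s)%N.
Hypothesis l3 : (3 <= l)%N.
Hypothesis g4 : (4 <= g)%N.
Hypothesis M_large : (1584 * s ^ 2 * c0 ^ 2 * K <= M)%N.
Hypothesis V_lt : (#|V| < 2 ^ l)%N.
Hypothesis V_le : (#|V| <= M * l ^ 2 * g ^ 2)%N.
Hypothesis g_large : (2 ^ l <= g ^ 5)%N.
Hypothesis b_le : (8 * b <= 4 ^ g)%N.
Notation Om := {ffun V -> {ffun 'I_b -> 'I_R}}.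
Let p : rat := s%:R / R%:R.

Lemma l_gt0 : (0 < l)%N. Proof. exact: leq_trans l3. Qed.
Lemma g_gt0 : (0 < g)%N. Proof. exact: leq_trans g4. Qed.

Lemma c0_gt0 : (0 < c0)%N.
Proof. by rewrite c0E /cost muln_gt0 expn_gt0 muln_gt0 s0. Qed.

Lemma K_gt0 : (0 < K)%N. Proof. by rewrite KE !expn_gt0. Qed.

Lemma M_gt0 : (0 < M)%N.
Proof.
by apply: leq_trans M_large; rewrite !muln_gt0 s0 c0_gt0 K_gt0.
Qed.

Lemma c0_le_M : (c0 <= M)%N.
Proof.
apply: leq_trans M_large.
rewrite (_ : (1584 * s ^ 2 * c0 ^ 2 * K = c0 * (1584 * s ^ 2 * c0 * K))%N); last by ring.
by rewrite leq_pmulr // !muln_gt0 s0 c0_gt0 K_gt0.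
Qed.

Lemma c0K_le_M : (c0 ^ 2 * K <= M)%N.
Proof.
apply: leq_trans M_large.
rewrite (_ : (1584 * s ^ 2 * c0 ^ 2 * K = c0 ^ 2 * K * (1584 * s ^ 2))%N); last by ring.
by rewrite leq_pmulr // !muln_gt0 s0.
Qed.

Lemma c0s_le_M : (1584 * s ^ 2 * c0 <= M)%N.
Proof.
apply: leq_trans M_large.
rewrite (_ : (1584 * s ^ 2 * c0 ^ 2 * K = 1584 * s ^ 2 * c0 * (c0 * K))%N); last by ring.
by rewrite leq_pmulr // muln_gt0 c0_gt0 K_gt0.
Qed.

Lemma m_gt0 : (0 < m)%N.
Proof. by rewrite mE !muln_gt0 M_gt0 l_gt0 g_gt0. Qed.

Lemma R_gt0 : (0 < R)%N.
Proof. by rewrite RE !muln_gt0 s0 m_gt0. Qed.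

Lemma s_le_R : (s <= R)%N.
Proof. by rewrite RE mulnAC leq_pmull // muln_gt0 m_gt0. Qed.

Lemma densE : p = (4 * m%:R)^-1.
Proof.
rewrite /p RE !natrM; field.
by rewrite !pnatr_eq0 -!lt0n s0 m_gt0.
Qed.

Lemma p_ge0 : 0 <= p. Proof. by rewrite divr_ge0 ?ler0n. Qed.

(** Here [b p = c0 l / 2], so the moment is at most [2 ^ (c0 l)]. The threshold [D = 2 c0 l] leaves
    [2 ^ -(c0 l)] per vertex, against fewer than [2 ^ l] vertices. *)
Lemma prob_degree_le :
  prob (fun w : Om => [exists v, xpredT v && (D < #|blocks s w v|)%N]) <= 8^-1.
Proof.
have c0E2 : c0 = (2 * (2 * (4 * s) ^ s))%N by rewrite c0E /cost mulnA.
have mr : m%:R != 0 :> rat by rewrite pnatr_eq0 -lt0n m_gt0.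
apply: (@le_trans _ _ (#|V|%:R * (2 ^+ (c0 * l))^-1)).
  apply: (prob_exists_le (c := (2 ^+ (c0 * l))^-1)) => [|v _|].
  - exact: max_card.
  - rewrite -(ler_pM2r (x := 2 ^+ D)) ?exprn_gt0 //.
    apply: le_trans (prob_degree b R_gt0 s_le_R D v) _.
    apply: (@le_trans _ _ (4 ^+ (2 * (4 * s) ^ s * l))).
      apply: expr1D_le4; first exact: p_ge0.
      rewrite -/p densE bE c0E2 !natrM le_eqVlt; apply/orP; left; apply/eqP.
      by field.
    have -> : (4 : rat) = 2 ^+ 2 by [].
    rewrite -exprM mulnA -c0E2 DE -mulnA mul2n -addnn exprD mulrA mulVf ?mul1r //.
    by rewrite expf_neq0.
  - by rewrite invr_ge0 exprn_ge0.
rewrite ler_pdivrMr ?exprn_gt0 // mulrC ler_pdivlMr //.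
rewrite -!natrX -natrM ler_nat (leq_trans (n := 2 ^ l * 2 ^ 3)) //.
  by rewrite leq_mul2r ltnW ?orbT.
have c04 : (4 <= c0)%N by rewrite c0E /cost leq_pmulr // expn_gt0 muln_gt0 s0.
rewrite -expnD leq_exp2l //; clear -c04 l3; nia.
Qed.

(** The mean block size is at most [g / 4], so the moment is at most [4 ^ g]. Dividing by
    [2 ^ (4 g)] leaves [4 ^ -g] per block, and [b_le] concludes. *)
Lemma prob_size_le :
  prob (fun w : Om => [exists i, xpredT i && (4 * g < #|block s w i|)%N]) <= 8^-1.
Proof.
have mr : m%:R != 0 :> rat by rewrite pnatr_eq0 -lt0n m_gt0.
apply: (@le_trans _ _ (b%:R * (4 ^+ g)^-1)).
  apply: (prob_exists_le (c := (4 ^+ g)^-1)) => [|i _|].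
  - by rewrite (leq_trans (max_card _)) ?card_ord.
  - rewrite -(ler_pM2r (x := 2 ^+ (4 * g))) ?exprn_gt0 //.
    apply: le_trans (prob_block_size V R_gt0 s_le_R (4 * g) i) _.
    apply: (@le_trans _ _ (4 ^+ g)).
      apply: expr1D_le4; first exact: p_ge0.
      rewrite -/p densE ler_pdivrMr; last first.
        by rewrite -natrM ltr0n muln_gt0 m_gt0.
      rewrite -!natrM ler_nat (leq_trans V_le) // mE; clear; nia.
    rewrite [(4 * g)%N]mulnC (_ : 4%N = (2 + 2)%N) // mulnDr exprD mulrC.
    by rewrite mulnC exprM (_ : 2 ^+ 2 = 4 :> rat) // mulfK // expf_neq0.
  - by rewrite invr_ge0 exprn_ge0.
rewrite ler_pdivrMr ?exprn_gt0 // mulrC ler_pdivlMr //.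
by rewrite -natrX -natrM ler_nat mulnC.
Qed.

(** Bounds the expected number of blocks meeting an [l]-set that contain a further vertex. The
    factor [l ^ 2] of [m] cancels, leaving order [1 / g]. *)
Lemma Np : (l * D)%:R * p = c0%:R / (2 * M%:R * g%:R).
Proof.
rewrite densE DE mE !natrM; field.
by rewrite !pnatr_eq0 -!lt0n M_gt0 l_gt0 g_gt0.
Qed.

Lemma draws_le : (#|V| ^ l <= 2 ^ (l ^ 2))%N.
Proof. by rewrite -mulnn expnM leq_exp2r ?(leq_trans _ l3) // ltnW. Qed.

(** The cap 6 gives [4 g / g ^ 7 <= 1 / g ^ 5] with [#|V| < g ^ 5], so the moment is at most 4.
    Since [g ^ (10 l) >= 2 ^ (2 l ^ 2)], the threshold [10 l] beats the [2 ^ (l ^ 2)] choices of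
    [Y]. *)
Lemma prob_crowded_le :
  prob (fun w : Om => [exists Y : {set V}, (#|Y| == l) &&
    ((#|blocksU s w Y| <= l * D) && (10 * l < #|crowded s 6 w Y|))%N]) <= 8^-1.
Proof.
have g0 := g_gt0.
have gp : 0 < g%:R :> rat by rewrite ltr0n.
have Mp : 0 < M%:R :> rat by rewrite ltr0n M_gt0.
apply: (@le_trans _ _ ((2 ^ (l ^ 2))%:R * (4 / (2 ^+ (2 * l ^ 2))))).
  apply: (prob_exists_le (c := 4 / (2 ^+ (2 * l ^ 2)))) => [|Y _|].
  - by apply: leq_trans (card_draws_le V l) draws_le.
  - rewrite -(ler_pM2r (x := g%:R ^+ (10 * l).+1)) ?exprn_gt0 //.
    apply: le_trans (prob_crowded b R_gt0 s_le_R (N := (l * D)%N) 6 (10 * l).+1 Y g0 _) _.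
      rewrite -/p mulrA Np mulrAC ler_pdivrMr ?mulr_gt0 // mul1r -!natrM ler_nat.
      by rewrite leq_mul2r (leq_trans c0_le_M) ?leq_pmull ?orbT.
    apply: (@le_trans _ _ 4).
      apply: (@expr1D_le4 _ _ 1); first by rewrite divr_ge0 ?mulr_ge0 ?exprn_ge0 ?ler0n.
      rewrite mulrA ler_pdivrMr ?exprn_gt0 // mul1r -natrX -!natrM ler_nat.
      rewrite (_ : g ^ 7 = g ^ 5 * (g * g))%N; last by ring.
      by rewrite leq_mul ?leq_mul2r ?g4 ?orbT // (leq_trans (ltnW V_lt)).
    rewrite mulrAC ler_pdivlMr ?exprn_gt0 // ler_wpM2l // -!natrX ler_nat.
    rewrite (leq_trans (n := g ^ (10 * l))) ?leq_pexp2l //.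
    rewrite (_ : 2 * l ^ 2 = l * (2 * l))%N; last by ring.
    rewrite (_ : 10 * l = 5 * (2 * l))%N; last by ring.
    by rewrite expnM [leqRHS]expnM leq_exp2r ?muln_gt0 ?l_gt0.
  - by rewrite divr_ge0 ?exprn_ge0.
rewrite mulrA ler_pdivrMr ?exprn_gt0 // [leRHS]mulrC ler_pdivlMr // -!natrX -!natrM ler_nat.
rewrite mul2n -addnn expnD mulnC.
rewrite (_ : (8 * _ = 32 * 2 ^ (l ^ 2))%N); last by ring.
rewrite leq_mul2r -[32%N]/(2 ^ 5)%N leq_exp2l // (leq_trans (n := 3 * 3)) ?orbT //.
by rewrite -mulnn leq_mul.
Qed.

(** By [Np] and the size of [M] the moment is at most [4 ^ (l ^ 2)]; this leaves [2 ^ -(6 l ^ 2)]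
    for each of at most [2 ^ (2 l ^ 2)] pairs. *)
Lemma prob_crossings_le :
  prob (fun w : Om => [exists YZ : {set V} * {set V},
    ((#|YZ.1| == l) && (#|YZ.2| == l)) &&
    [&& [disjoint blocksU s w YZ.1 & blocksU s w YZ.2],
      #|blocksU s w YZ.1| <= l * D, #|blocksU s w YZ.2| <= l * D &
      l ^ 2 <= 16 * s ^ 2 * crossings s 6 w YZ.1 YZ.2]%N]) <= 8^-1.
Proof.
have gp : 0 < g%:R :> rat by rewrite ltr0n g_gt0.
have Mp : 0 < M%:R :> rat by rewrite ltr0n M_gt0.
have c0p : 0 < c0%:R :> rat by rewrite ltr0n c0_gt0.
apply: (@le_trans _ _ ((2 ^ (2 * l ^ 2))%:R * (2 ^+ (6 * l ^ 2))^-1)).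
  apply: (prob_exists_le (c := (2 ^+ (6 * l ^ 2))^-1)) => [|[Y Z] _|].
  - rewrite mul2n -addnn expnD.
    apply: leq_trans (leq_mul draws_le draws_le).
    apply: leq_trans (leq_mul (card_draws_le V l) (card_draws_le V l)).
    by rewrite -cardX; apply/subset_leq_card/subsetP => YZ; rewrite !inE.
  - rewrite -(ler_pM2r (x := 2 ^+ (8 * l ^ 2))) ?exprn_gt0 //.
    apply: le_trans (prob_crossings b R_gt0 s_le_R (N := (l * D)%N) (l ^ 2) Y Z _) _.
      rewrite -/p -KE mulrA Np mulrAC ler_pdivrMr ?mulr_gt0 //.
      rewrite mulrA mulrA mulVf // mul1r -!natrM ler_nat.
      rewrite (leq_trans (n := c0 ^ 2 * K)) //.
        by rewrite leq_mul2r -mulnn leq_pmulr ?orbT ?c0_gt0.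
      by rewrite (leq_trans c0K_le_M) // leq_pmulr // g_gt0.
    apply: (@le_trans _ _ (4 ^+ (l ^ 2))).
      apply: expr1D_le4; first by rewrite mulr_ge0 ?ler0n // mulr_ge0 ?sqr_ge0.
      rewrite -/p -KE Np.
      have MK : c0%:R ^+ 2 * K%:R <= M%:R :> rat.
        by rewrite -natrX -natrM ler_nat c0K_le_M.
      apply: (@le_trans _ _ ((M * l ^ 2 * g ^ 2)%:R *
          (2 * (c0%:R / (2 * M%:R * g%:R)) ^+ 2 * K%:R))).
        by rewrite ler_wpM2r ?ler_nat // mulr_ge0 ?ler0n // mulr_ge0 ?sqr_ge0.
      rewrite !natrM.
      rewrite (_ : _ * _ = l%:R ^+ 2 * ((c0%:R ^+ 2 * K%:R) / (2 * M%:R))); last first.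
        by field; rewrite !gt_eqF.
      rewrite ler_piMr ?sqr_ge0 // ler_pdivrMr ?mulr_gt0 // mul1r.
      by apply: le_trans MK _; rewrite ler_peMl ?ler0n // ler1n.
    rewrite (_ : 4 = 2 ^+ 2 :> rat) // -exprM
      (_ : 8 * l ^ 2 = 6 * l ^ 2 + 2 * l ^ 2)%N; last by ring.
    by rewrite exprD mulrA mulVf ?mul1r // expf_neq0.
  - by rewrite invr_ge0 exprn_ge0.
rewrite ler_pdivrMr ?exprn_gt0 // [leRHS]mulrC ler_pdivlMr // -!natrX -!natrM ler_nat.
rewrite (_ : 6 * l ^ 2 = 4 * l ^ 2 + 2 * l ^ 2)%N; last by ring.
rewrite expnD mulnC leq_mul2r -[8%N]/(2 ^ 3)%N leq_exp2l //.
rewrite (leq_trans (n := 4 * 3)) ?orbT // leq_mul2l -mulnn (leq_trans l3) ?leq_pmulr ?l_gt0 //.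
Qed.

(** Since [b = c0 * (2 m l)], a given set survives with probability at most [2 ^ -(2 m l)], while
    there are at most [2 ^ (l m)] sets. *)
Lemma prob_survives_le :
  prob (fun w : Om => [exists X : {set V}, (#|X| == m) && survives s m b w X]) <= 8^-1.
Proof.
have c1 : (1 < c0)%N by rewrite c0E /cost (leq_trans (n := 4)) // leq_pmulr // expn_gt0 muln_gt0 s0.
have c0p : 0 < c0%:R :> rat by rewrite ltr0n c0_gt0.
(* Through the reciprocal: Bernoulli gives [(1 + 1 / (c0 - 1)) ^ c0 >= 2]. *)
have half : (1 - c0%:R^-1) ^+ c0 <= 2^-1 :> rat.
  have dn : 0 < c0%:R - 1 :> rat by rewrite subr_gt0 ltr1n.
  have B : 2 <= (c0%:R / (c0%:R - 1)) ^+ c0 :> rat.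
    have -> : c0%:R / (c0%:R - 1) = 1 + (c0%:R - 1)^-1 :> rat by field; rewrite gt_eqF.
    apply: le_trans (bernoulli _ _); last first.
      by apply: (@le_trans _ _ 0) => //; rewrite invr_ge0 ltW.
    by rewrite -[2]/(1 + 1) lerD2l ler_pdivlMr // mul1r gerBl.
  rewrite (_ : 1 - _ = (c0%:R / (c0%:R - 1))^-1); last by field; rewrite !gt_eqF.
  by rewrite exprVn lef_pV2 // posrE (lt_le_trans _ B).
apply: (@le_trans _ _ ((2 ^ (l * m))%:R * (2 ^+ (2 * m * l))^-1)).
  apply: (prob_exists_le (c := (2 ^+ (2 * m * l))^-1)) => [|X /eqP cX|].
  - apply: leq_trans (card_draws_le V m) _.
    by rewrite expnM leq_exp2r ?m_gt0 // ltnW.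
  - apply: le_trans (prob_survives s0 m_gt0 RE cX (leqnn b)) _.
    rewrite -c0E bE (_ : 2 * c0 * m * l = c0 * (2 * m * l))%N; last by ring.
    rewrite exprM -exprVn; apply: lerXn2r => //; rewrite nnegrE ?invr_ge0 //.
    by rewrite exprn_ge0 // subr_ge0 invf_le1 // ler1n c0_gt0.
  - by rewrite invr_ge0 exprn_ge0.
rewrite ler_pdivrMr ?exprn_gt0 // [leRHS]mulrC ler_pdivlMr // -!natrX -!natrM ler_nat.
rewrite (_ : 2 * m * l = l * m + l * m)%N; last by ring.
rewrite expnD leq_mul2l -[8%N]/(2 ^ 3)%N leq_exp2l // (leq_trans l3) ?orbT //.
by rewrite leq_pmulr // m_gt0.
Qed.

Lemma exists_block_graph : exists E : {ffun V * V -> bool},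
  [/\ simple_graph E, K_free E s.+1 &
    forall X : {set V}, #|X| = m -> contains_K E X s].
Proof.
have [w] : exists w : Om, ~~ [|| [exists v, xpredT v && (D < #|blocks s w v|)%N],
    [exists i, xpredT i && (4 * g < #|block s w i|)%N],
    [exists Y : {set V}, (#|Y| == l) &&
      ((#|blocksU s w Y| <= l * D) && (10 * l < #|crowded s 6 w Y|))%N],
    [exists YZ : {set V} * {set V}, ((#|YZ.1| == l) && (#|YZ.2| == l)) &&
      [&& [disjoint blocksU s w YZ.1 & blocksU s w YZ.2],
        #|blocksU s w YZ.1| <= l * D, #|blocksU s w YZ.2| <= l * D &
        l ^ 2 <= 16 * s ^ 2 * crossings s 6 w YZ.1 YZ.2]%N] |
    [exists X : {set V}, (#|X| == m) && survives s m b w X]].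
  apply: prob_lt1; first exact: (Om_gt0 V b R_gt0).
  (* Five bad events of probability at most 1/8 each. *)
  apply: (@le_lt_trans _ _ (8^-1 + (8^-1 + (8^-1 + (8^-1 + 8^-1))))); last by lra.
  apply: le_trans (probU _ _) _; apply: lerD; first exact: prob_degree_le.
  apply: le_trans (probU _ _) _; apply: lerD; first exact: prob_size_le.
  apply: le_trans (probU _ _) _; apply: lerD; first exact: prob_crowded_le.
  apply: le_trans (probU _ _) _; apply: lerD; first exact: prob_crossings_le.
  exact: prob_survives_le.
rewrite !negb_or => /and5P[/existsPn F1 /existsPn F2 /existsPn F3 /existsPn F4 /existsPn F5].
have degree_le v : (#|blocks s w v| <= D)%N by rewrite leqNgt; exact: F1.
have size_le i : (#|block s w i| <= 4 * g)%N by rewrite leqNgt; exact: F2.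
have blocksU_le (Y : {set V}) : #|Y| = l -> (#|blocksU s w Y| <= l * D)%N.
  by move=> <-; apply: card_blocksU.
exists (block_graph s w); split=> [||X cX].
- exact: block_graph_simple.
- exact: block_graph_K_free.
have nX : (2 * s ^ 2 * nnear s w b X <= m ^ 2)%N.
  apply: (nnear_le degree_le size_le l_gt0 m_gt0 s0 (t := 10 * l)) => //.
  - move=> Y cY; have := F3 Y; rewrite cY eqxx /= blocksU_le //=.
    by rewrite -leqNgt.
  - move=> Y Z cY cZ dJ; have := F4 (Y, Z); rewrite /= cY cZ !eqxx dJ /=.
    by rewrite !blocksU_le //= -ltnNge.
  (* [1584 = 16 * 11 * 9]: here [t + l = 11 l], and [D * (4 g) + 1 = 8 c0 l g + 1 <= 9 c0 l g]. *)
  rewrite mE DE; apply: (@leq_trans (1584 * s ^ 2 * c0 * l ^ 2 * g)).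
    have c0l : (0 < c0 * l * g)%N by rewrite !muln_gt0 c0_gt0 l_gt0 g_gt0.
    rewrite (_ : 1584 * s ^ 2 * c0 * l ^ 2 * g =
      16 * s ^ 2 * (11 * l * (9 * (c0 * l * g))))%N; last by ring.
    rewrite leq_mul2l (_ : 10 * l + l = 11 * l)%N; last by ring.
    rewrite leq_mul2l (_ : 2 * c0 * l * (4 * g) = 8 * (c0 * l * g))%N; last by ring.
    have lt89 : (8 * (c0 * l * g) < 9 * (c0 * l * g))%N by rewrite ltn_mul2r c0l.
    by rewrite lt89 !orbT.
  by rewrite !leq_mul2r c0s_le_M !orbT.
(* Near pairs and neighbourhoods only grow with the number of blocks, so the bounds after all [b]
   blocks apply at each stage. *)
have reg (i : 'I_b) : regular s m w i X.
  apply/andP; split.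
    apply: leq_trans nX; rewrite leq_mul2l; apply/orP; right.
    apply/subset_leq_card/subsetP => q; rewrite !inE => /andP[-> /=].
    by apply: near_le; rewrite ltnW.
  apply/forall_inP => x _; apply: (@leq_trans (s * (D * (4 * g)))).
    rewrite leq_mul2l; apply/orP; right.
    apply: leq_trans (card_nbhd degree_le size_le x).
    apply/subset_leq_card/subsetP => z; rewrite !inE.
    by apply: share_le; rewrite ltnW.
  rewrite mE DE; apply: (@leq_trans (1584 * s ^ 2 * c0 * l ^ 2 * g)).
    rewrite (_ : s * (2 * c0 * l * (4 * g)) = 8 * s * c0 * l * g)%N; last by ring.
    rewrite (_ : 1584 * s ^ 2 * c0 * l ^ 2 * g = 8 * s * c0 * l * g * (198 * s * l))%N;
      last by ring.
    by rewrite leq_pmulr // !muln_gt0 s0 l_gt0.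
  by rewrite !leq_mul2r c0s_le_M !orbT.
have := F5 X; rewrite cX eqxx /= => /forallPn[i].
rewrite negb_imply reg /= negbK => /andP[_ sc].
exact: success_contains sc.
Qed.

End Existence.

(** * Choice of parameters *)

Local Open Scope nat_scope.

(** A larger set free of [K_s] would contain such a set with exactly [m] vertices. *)
Lemma f_ER_le (s n m : nat) (E : {ffun 'I_n * 'I_n -> bool}) :
  simple_graph E -> K_free E s.+1 ->
  (forall X : {set 'I_n}, #|X| = m -> contains_K E X s) -> f_ER s n <= m.
Proof.
move=> sE fE hE; apply/bigmax_leqP => k /forallP/(_ E); rewrite sE fE /=.
case/existsP=> A /andP[/eqP cA nA]; rewrite leqNgt; apply: contra nA => mk.
have [B BA cB] : exists2 B : {set 'I_n}, B \subset A & #|B| = m.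
  exists [set x in take m (enum A)].
    by apply/subsetP => x; rewrite inE => /mem_take; rewrite mem_enum.
  have ut : uniq (take m (enum A)) by rewrite take_uniq ?enum_uniq.
  by rewrite cardsE (card_uniqP ut) size_takel // -cardE cA ltnW.
have /existsP[C /and3P[CB cC clC]] := hE B cB.
by apply/existsP; exists C; rewrite (subset_trans CB BA) cC.
Qed.

(** With [q = l / (k + 1)] rounded down, [2 ^ l >= (q + 1) ^ (k + 1)]: one factor [q + 1] absorbs
    the constants, the others absorb [l ^ k]. *)
Lemma poly_le_exp2 (C k : nat) : exists l0, forall l, l0 <= l -> C * l ^ k <= 2 ^ l.
Proof.
exists (k.+1 * (C * k.+1 ^ k)) => l ll0; set q := l %/ k.+1.
have lq : l <= k.+1 * q.+1.
  by rewrite mulnC ltnW // ltn_ceil.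
have Cq : C * k.+1 ^ k <= q.+1.
  by rewrite leqW // leq_divRL // mulnC.
apply: (@leq_trans (q.+1 ^ k.+1)).
  rewrite expnS; apply: (@leq_trans (C * (k.+1 ^ k * q.+1 ^ k))).
    rewrite leq_mul2l -expnMn; apply/orP; right.
    by case: (k) lq => // k' lq; rewrite leq_exp2r.
  by rewrite mulnA leq_mul.
apply: (@leq_trans (2 ^ (q * k.+1))); last by rewrite leq_exp2l // leq_trunc_div.
by rewrite expnM leq_exp2r // ltn_expl.
Qed.

(* l is about log n, and g about sqrt n / (M l), so that M^2 l^2 g is about
   M sqrt n log n. *)
Lemma parameters (M c0 : nat) : 0 < M -> exists N, forall n, N <= n ->
  exists l g, [/\ [/\ 3 <= l, 4 <= g, n < 2 ^ l, 2 ^ l.-1 <= n & (M * l) ^ 2 <= n],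
    n <= M ^ 2 * l ^ 2 * g ^ 2, (M * l * g.-1) ^ 2 <= n,
    2 ^ l <= g ^ 5 & 8 * (2 * c0 * (M ^ 2 * l ^ 2 * g) * l) <= 4 ^ g].
Proof.
move=> M0.
have [g0 Hg0] := poly_le_exp2 (2000 * c0 * M ^ 2) 4.
have [l1 Hl1] := poly_le_exp2 (32 * M ^ 10) 10.
have [l2 Hl2] := poly_le_exp2 (2 * M ^ 2) 2.
(* [10] yields [4 <= g] as [2 ^ 10 = 4 ^ 5], and [g0 ^ 5] yields [g0 <= g], both through
   [2 ^ l <= g ^ 5]. *)
pose l0 := maxn (maxn 10 (g0 ^ 5)) (maxn l1 l2).
exists (2 ^ l0) => n Nn; pose l := (trunc_log 2 n).+1.
have n0 : 0 < n by apply: leq_trans Nn; rewrite expn_gt0.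
have n_lt : n < 2 ^ l by apply: trunc_log_ltn.
have n_ge : 2 ^ l.-1 <= n by apply: trunc_logP.
have l_ge : l0 <= l.
  by rewrite leqW // trunc_log_max.
move: l_ge; rewrite !geq_max => /andP[/andP[l10 lg0] /andP[ll1 ll2]].
have pl : 2 ^ l = 2 * 2 ^ l.-1 by rewrite -expnS.
have l_gt0 : 0 < l by [].
have Ml : (M * l) ^ 2 <= n.
  apply: leq_trans n_ge; rewrite -(leq_pmul2l (ltn0Sn 1)) -pl.
  by apply: leq_trans (Hl2 _ ll2); rewrite expnMn mulnA.
have exg : exists g, n <= (M * l * g) ^ 2.
  exists n; rewrite -mulnn (leq_trans (n := n * n)) ?leq_pmulr //.
  by rewrite leq_mul // leq_pmull // muln_gt0 M0.
(* Minimality puts [n] between [(M l (g - 1))^2] and [(M l g)^2]. *)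
case: (ex_minnP exg) => g gn gmin.
(* The fifth power of [2 ^ (l - 1) <= (M l g)^2] bounds [2 ^ (5 l)] by [32 (M l)^10 g^10], and
   [2 ^ l] exceeds [32 (M l)^10]. *)
have g_big : 2 ^ l <= g ^ 5.
  rewrite -(leq_exp2r (2 ^ l) (g ^ 5) (isT : 0 < 2)) -!expnM.
  have Ml10 : 0 < 32 * (M * l) ^ 10 by rewrite muln_gt0 expn_gt0 muln_gt0 M0.
  rewrite -(leq_pmul2r Ml10).
  apply: (@leq_trans (2 ^ (l * 2) * 2 ^ l)).
    by apply: leq_mul (leqnn _) _; rewrite expnMn mulnA; exact: Hl1.
  apply: (@leq_trans (2 ^ (l * 5))).
    by rewrite -expnD -mulnSr leq_exp2l // leq_mul2l orbT.
  rewrite expnM pl expnMn mulnA [leqRHS](_ : _ = 2 ^ 5 * (((M * l * g) ^ 2) ^ 5)).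
    by rewrite leq_mul2l leq_exp2r // (leq_trans n_ge gn) orbT.
  by rewrite [X in _ = X * _](_ : _ = 32) //; ring.
have g4 : 4 <= g.
  rewrite -(leq_exp2r _ _ (isT : 0 < 5)) (leq_trans _ g_big) //.
  by rewrite (_ : 4 ^ 5 = 2 ^ 10) // leq_exp2l.
have gg0 : g0 <= g.
  rewrite -(leq_exp2r _ _ (isT : 0 < 5)) (leq_trans _ g_big) //.
  by rewrite (leq_trans lg0) // ltnW // ltn_expl.
exists l, g; split=> //.
- by split=> //; apply: leq_trans l10.
- by rewrite -!expnMn.
- case: g g4 gmin {gn g_big gg0} => // g _ gmin /=.
  by rewrite leqNgt; apply/negP => /ltnW/gmin; rewrite ltnn.
have lg : l <= 5 * g.
  rewrite -(leq_exp2l (m := 2)) // (leq_trans g_big) // mulnC expnM leq_exp2r //.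
  by rewrite ltnW // ltn_expl.
(* [2000 = 16 * 5 ^ 3], from [l <= 5 g]. *)
apply: (@leq_trans (2000 * c0 * M ^ 2 * g ^ 4)).
  rewrite (_ : 8 * _ = 16 * c0 * M ^ 2 * (l ^ 3) * g); last by ring.
  rewrite (_ : 2000 * _ * _ * _ = 16 * c0 * M ^ 2 * ((5 * g) ^ 3) * g); last by ring.
  by rewrite leq_mul // leq_mul // leq_exp2r.
by apply: leq_trans (Hg0 _ gg0) _; rewrite leq_exp2r // (leq_trans _ g4).
Qed.

(** Writing [g = h + 1] splits the bound into terms [M l h] and [M l], each at most [sqrt n], so
    rounding [g] up is harmless. *)
Lemma f_ER_bound (s : nat) : 0 < s -> exists2 M, 0 < M & exists N, forall n, N <= n ->
  exists l h, [/\ f_ER s n <= M * l * (M * l * h + M * l), 2 <= l, 2 ^ l.-1 <= n,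
    M * l * h * (M * l * h) <= n & M * l * (M * l) <= n].
Proof.
move=> s0; set c0 := cost s; set K := (2 ^ (8 * (16 * s ^ 2))) ^ 6.
set M := 1584 * s ^ 2 * c0 ^ 2 * K.
have c0_gt0 : 0 < c0 by rewrite muln_gt0 expn_gt0 muln_gt0 s0.
have K_gt0 : 0 < K by rewrite expn_gt0 expn_gt0.
have M_gt0 : 0 < M.
  by rewrite /M muln_gt0 K_gt0 andbT muln_gt0 expn_gt0 c0_gt0 andbT muln_gt0 expn_gt0 s0.
exists M => //; have [N HN] := parameters c0 M_gt0; exists N => n /HN[l [g]].
case=> [[l3 g4 n_lt n_ge Ml] n_le gn g5 b_le]; exists l, g.-1.
(* The construction is run with [M ^ 2] in the role of its [M], so its size condition reads
   [n <= (M l g)^2]. *)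
have MM : 1584 * s ^ 2 * c0 ^ 2 * K <= M ^ 2.
  by rewrite -/M -mulnn leq_pmulr.
have [E [sE fE hE]] : exists E : {ffun 'I_n * 'I_n -> bool},
    [/\ simple_graph E, K_free E s.+1 &
      forall X : {set 'I_n}, #|X| = M ^ 2 * l ^ 2 * g -> contains_K E X s].
  by apply: (exists_block_graph (erefl c0) (erefl K) (erefl _) (erefl _) (erefl _)
    (erefl _) s0 l3 g4 MM); rewrite ?card_ord.
split; rewrite ?(ltnW l3) ?mulnn //.
apply: leq_trans (f_ER_le sE fE hE) _.
rewrite -mulnSr -[in leqRHS](prednK (n := g)) ?(leq_trans _ g4) //=.
by rewrite prednK ?(leq_trans _ g4) // mulnA mulnn expnMn.
Qed.

(* Passage to real square roots and logarithms *)
From Stdlib Require Import Reals Lra.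
Open Scope R_scope.

Lemma INR_exp2 (k : nat) : INR (expn 2 k) = 2 ^ k.
Proof.
elim: k => [|k IH]; first by rewrite expn0.
by rewrite expnS -[muln 2 _]/(Nat.mul 2 _) mult_INR IH.
Qed.

Lemma INR_le_sqrt (a n : nat) : leq (muln a a) n -> INR a <= sqrt (INR n).
Proof.
move=> /ssrnat.leP/le_INR; rewrite -[muln a a]/(Nat.mul a a) mult_INR => an.
have := pos_INR a; move=> a0.
rewrite -(sqrt_square (INR a)) //; exact: sqrt_le_1_alt.
Qed.

(** As [ln 2 > 1/2], [l - 1 <= 2 ln n]; and [l <= 2 (l - 1)] since [l >= 2]. *)
Lemma log_bound (l n : nat) : leq 2 l -> leq (expn 2 l.-1) n ->
  INR l <= 4 * ln (INR n).
Proof.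
case: l => [|[|l]] // _; rewrite [l.+2.-1]/= => /ssrnat.leP/le_INR.
rewrite INR_exp2 => n_ge.
have p0 : 0 < 2 ^ l.+1 by apply: pow_lt; Lra.lra.
have : ln (2 ^ l.+1) <= ln (INR n).
  by case: n_ge => [lt|->]; [left; apply: ln_increasing | right].
rewrite ln_pow; last by Lra.lra.
have := ln_lt_2; have := pos_INR l; rewrite !S_INR.
move: (INR l) (ln 2) (ln (INR n)) => x y z x0 y0 xyz.
have : 0 <= (x + 1) * (y - / 2) by apply: Rmult_le_pos; Lra.lra.
Lra.lra.
Qed.

Theorem theorem1p1 :
  forall s : nat, leq 3 s ->
  exists C : R, 0 < C /\
  exists N : nat, forall n : nat, leq N n ->
    INR (f_ER s n) <= C * sqrt (INR n) * ln (INR n).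
Proof.
move=> s s3; have [M M0 [N HN]] := f_ER_bound (leq_trans (isT : leq 1 3) s3).
have MR : 0 < INR M by apply: lt_0_INR; apply/ssrnat.ltP.
(* [8 = 4 * 2]: [l] is at most [4 ln n], and the two terms are together at most [2 sqrt n]. *)
exists (8 * INR M); split; first by Lra.lra.
exists N => n /HN[l [h [f_le l2 n_ge /INR_le_sqrt hn /INR_le_sqrt hMl]]].
have Il := log_bound l2 n_ge.
have := le_INR _ _ (elimT ssrnat.leP f_le).
have EM : INR (muln M l) = INR M * INR l := mult_INR M l.
rewrite -[muln (muln M l) _]/(Nat.mul (muln M l) (Nat.add (muln (muln M l) h) (muln M l))).
rewrite mult_INR plus_INR EM => H; rewrite EM in hMl.
have := pos_INR l; have := sqrt_pos (INR n).
move: hn hMl Il H.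
move: (INR (muln _ h)) (INR l) (INR M) MR (sqrt _) (ln _) (INR (f_ER _ _)) =>
  a L m m0 q z f ha hd hL H q0 L0.
apply: Rle_trans H _.
have mL : 0 <= m * L by apply: Rmult_le_pos; Lra.lra.
apply: (Rle_trans _ (m * L * (2 * q))); first by apply: Rmult_le_compat_l; Lra.lra.
have : m * L * (2 * q) <= m * (4 * z) * (2 * q); last by Lra.lra.
apply: Rmult_le_compat_r; first by Lra.lra.
by apply: Rmult_le_compat_l; Lra.lra.
Qed.
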